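(* Let $a,b\in\widetilde{\mathbb R}$ with $a<b$, let $F\in\mathcal{GC}^\infty([a,b]\times\widetilde{\mathbb R}^d\times\widetilde{\mathbb R}^d,\widetilde{\mathbb R})$, let $I(u)=\int_a^bF(t,u,\dot u)\,dt$, let $p,q\in\widetilde{\mathbb R}^d$, and let $u$ be a local minimizer of $I$ in $\mathcal{GC}^\infty_{\mathrm{bd}}(p,q)$. Then (i) $\delta I(u;\eta)=0$ for all $\eta\in\mathcal{GC}^\infty_0(a,b)$; (ii) $\delta^2I(u;\eta)\ge0$ for all $\eta\in\mathcal{GC}^\infty_0(a,b)$.
   Context: Generalized numbers. Let $I_0=(0,1]\subseteq\mathbb R$; ''for $\varepsilon$ small'' means for all $\varepsilon\in(0,\varepsilon_0]$ for some $\varepsilon_0\in I_0$. Fix a net $\rho=(\rho_\varepsilon)_{\varepsilon\in I_0}$ of reals with $\rho_\varepsilon\to0^+$ as $\varepsilon\to0^+$. A net $(x_\varepsilon)$ in $\mathbb R^n$ is moderate if $|x_\varepsilon|=O(\rho_\varepsilon^{-N})$ for some $N\in\mathbb R_{>0}$; $(x_\varepsilon)\sim(y_\varepsilon)$ if $|x_\varepsilon-y_\varepsilon|=O(\rho_\varepsilon^{N})$ for every $N\in\mathbb R_{>0}$. $\widetilde{\mathbb R}$ is the ring of moderate real nets modulo $\sim$, with classes $[x_\varepsilon]$; $\widetilde{\mathbb R}^n$ is defined analogously. $\mathbb R\subseteq\widetilde{\mathbb R}$ via constant nets. $x\le y$ iff there are representatives with $x_\varepsilon\le y_\varepsilon$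 for all $\varepsilon$; $x<y$ iff $y-x\ge0$ and $y-x$ is invertible; $|[x_\varepsilon]|=[|x_\varepsilon|]$ (Euclidean norm); $\max([x_\varepsilon],[y_\varepsilon])=[\max(x_\varepsilon,y_\varepsilon)]$. $[a,b]=\{x\in\widetilde{\mathbb R}:a\le x\le b\}$. The sharp topology on $\widetilde{\mathbb R}^n$ has as base the balls $B_r(c)=\{x:|x-c|<r\}$, $r\in\widetilde{\mathbb R}_{>0}$. Generalized smooth functions (GSF). For open $\Omega_\varepsilon\subseteq\mathbb R^n$, $\langle\Omega_\varepsilon\rangle$ is the set of $[x_\varepsilon]\in\widetilde{\mathbb R}^n$ such that for every representative $x_\varepsilon\in\Omega_\varepsilon$ for $\varepsilon$ small. For $X\subseteq\widetilde{\mathbb R}^n$, $Y\subseteq\widetilde{\mathbb R}^k$, $\mathcal{GC}^\infty(X,Y)$ is the set of maps $f:X\to Y$ for which there are $f_\varepsilon\in C^\infty(\Omega_\varepsilon,\mathbb R^k)$ with $X\subseteq\langle\Omega_\varepsilon\rangle$, $f([x_\varepsilon])=[f_\varepsilon(x_\varepsilon)]$ and $(\partial^\alpha f_\varepsilon(x_\varepsilon))$ moderate for all $[x_\varepsilon]\in X$ and all multi-indices $\alpha$. Derivatives are $\partial^\alpha f([x_\varepsilon])=[\partial^\alpha f_\varepsilon(x_\varepsilon)]$ at sharply interior points and one-sided limits at endpoints of intervals. $\int_a^bf(t)\,dt=[\int_{a_\varepsilon}^{b_\varepsilon}f_\varepsilon(t)\,dt]$. Variational notions. $\mathcal{GC}^\infty_0(a,b)=\{\eta\in\mathcal{GC}^\infty(\widetilde{\mathbb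 R},\widetilde{\mathbb R}^d):\eta(a)=0=\eta(b)\}$ (restricted to $[a,b]$ when needed). $\mathcal{GC}^\infty_{\mathrm{bd}}(p,q)=\{v\in\mathcal{GC}^\infty([a,b],\widetilde{\mathbb R}^d):v(a)=p,\ v(b)=q\}$. For $m\in\mathbb N$ ($0\in\mathbb N$) and $v\in\mathcal{GC}^\infty([a,b],\widetilde{\mathbb R}^d)$, $\|v\|_m=\max_{n\le m,\,1\le i\le d}\max\left(\left|\frac{d^nv^i}{dt^n}(M_{ni})\right|,\left|\frac{d^nv^i}{dt^n}(m_{ni})\right|\right)\in\widetilde{\mathbb R}$, where $m_{ni},M_{ni}\in[a,b]$ are points at which $\frac{d^nv^i}{dt^n}$ attains its minimum resp. maximum over $[a,b]$ (they exist, and the value does not depend on their choice). $B^m_r(u)=\{v\in\mathcal{GC}^\infty([a,b],\widetilde{\mathbb R}^d):\|v-u\|_m<r\}$. $u$ is a local minimizer of $I$ in $\mathcal{GC}^\infty_{\mathrm{bd}}(p,q)$ if $u\in\mathcal{GC}^\infty_{\mathrm{bd}}(p,q)$ and there are $r\in\widetilde{\mathbb R}_{>0}$, $m\in\mathbb N$ with $I(v)\ge I(u)$ for all $v\in B^m_r(u)\cap\mathcal{GC}^\infty_{\mathrm{bd}}(p,q)$. $\delta I(u;\eta)=\frac{d}{ds}I(u+s\eta)|_{s=0}$ and $\delta^2I(u;\eta)=\frac{d^2}{ds^2}I(u+s\eta)|_{s=0}$. *)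

(* Defs.v *)
From HB Require Import structures.
From mathcomp Require Import all_boot all_order all_algebra.
From mathcomp Require Import generic_quotient ring_quotient.
From mathcomp Require Import all_classical all_reals all_analysis.

Set Implicit Arguments.
Unset Strict Implicit.
Unset Printing Implicit Defensive.
Import Order.TTheory GRing.Theory Num.Theory.
Import numFieldNormedType.Exports.

Local Open Scope classical_set_scope.
Local Open Scope ring_scope.
Local Open Scope quotient_scope.

(* Nets indexed by (0, 1] are encoded as functions on R whose values outside
   (0, 1] are irrelevant: the filter 0^'+ says "for epsilon small", and pointwise
   conditions on nets are only imposed for epsilon in (0, 1]. *)
Record asymptotic_gauge (R : realType) := Gauge {
  gauge_net :> R -> R;
  gauge_cvg : gauge_net e @[e --> 0^'+] --> 0^'+ }.

Definition I0 {R : realType} : set R := [set e | 0 < e <= 1].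

Section EuclideanNets.
Context {R : realType} (rho : asymptotic_gauge R).

(* The library norm on 'rV[R]_n is the sup norm. *)
Definition enorm n (x : 'rV[R]_n) : R := Num.sqrt (\sum_i x 0 i ^+ 2).

Definition net_moderate (x : R -> R) : Prop :=
  exists2 N : R, 0 < N & x =O_ (0^'+) (fun e : R => rho e `^ (- N)).

Definition net_negligible (x : R -> R) : Prop :=
  forall N : R, 0 < N -> x =O_ (0^'+) (fun e : R => rho e `^ N).

Definition vnet_moderate n (x : R -> 'rV[R]_n) : Prop := net_moderate (fun e => enorm (x e)).

Definition vnet_negligible n (x : R -> 'rV[R]_n) : Prop := net_negligible (fun e => enorm (x e)).

End EuclideanNets.

Section NetFacts.
Context {R : realType} (rho : asymptotic_gauge R).
Implicit Types x y : R -> R.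

Lemma gauge_gt0 : \forall e \near 0^'+, 0 < rho e.
Proof. exact: (@gauge_cvg _ rho _ (nbhs_right_gt 0)). Qed.

Lemma gauge_lt c : 0 < c -> \forall e \near 0^'+, rho e < c.
Proof. by move=> c0; exact: (@gauge_cvg _ rho _ (nbhs_right_lt c0)). Qed.

Lemma bigOE_near (x g : R -> R) : x =O_ (0^'+) g <->
  exists2 k, 0 < k & \forall e \near 0^'+, `|x e| <= k * `|g e|.
Proof. exact: eqO_exP. Qed.

Lemma moderateP x : net_moderate rho x <-> exists k N : R,
  [/\ 0 < k, 0 < N & \forall e \near 0^'+, `|x e| <= k * rho e `^ (- N)].
Proof.
split=> [[N N0 /bigOE_near[k k0 xk]]|[k [N [k0 N0 xk]]]].
  by exists k, N; split=> //; near=> e; rewrite -[rho e `^ _]ger0_norm ?powR_ge0//;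
    near: e.
exists N => //; apply/bigOE_near; exists k => //.
by near=> e; rewrite [`|rho e `^ _|]ger0_norm ?powR_ge0//; near: e.
Unshelve. all: by end_near. Qed.

Lemma negligibleP x : net_negligible rho x <-> forall N : R, 0 < N ->
  exists2 k : R, 0 < k & \forall e \near 0^'+, `|x e| <= k * rho e `^ N.
Proof.
split=> xn N N0.
  have /bigOE_near[k k0 xk] := xn N N0; exists k => //.
  by near=> e; rewrite -[rho e `^ _]ger0_norm ?powR_ge0//; near: e.
have [k k0 xk] := xn N N0; apply/bigOE_near; exists k => //.
by near=> e; rewrite [`|rho e `^ _|]ger0_norm ?powR_ge0//; near: e.
Unshelve. all: by end_near. Qed.

Lemma moderate_le x y : (\forall e \near 0^'+, `|x e| <= `|y e|) ->
  net_moderate rho y -> net_moderate rho x.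
Proof.
move=> xy /moderateP[k [N [k0 N0 yk]]]; apply/moderateP; exists k, N; split=> //.
by near=> e; apply: (@le_trans _ _ `|y e|); near: e.
Unshelve. all: by end_near. Qed.

Lemma negligible_le x y : (\forall e \near 0^'+, `|x e| <= `|y e|) ->
  net_negligible rho y -> net_negligible rho x.
Proof.
move=> xy /negligibleP yn; apply/negligibleP => N N0.
have [k k0 yk] := yn N N0; exists k => //.
by near=> e; apply: (@le_trans _ _ `|y e|); near: e.
Unshelve. all: by end_near. Qed.

Lemma moderate_cst (c : R) : net_moderate rho (fun=> c).
Proof.
apply/moderateP; exists (`|c| + 1), 1; split=> //.
near=> e.
have r0 : 0 < rho e by near: e; exact: gauge_gt0.
have r1 : rho e < 1 by near: e; exact: gauge_lt.
rewrite (le_trans (y := `|c| + 1)) ?lerDl// ler_peMr ?addr_ge0//.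
by rewrite powRN (powRr1 (ltW r0)) invf_ge1// ltW.
Unshelve. all: by end_near. Qed.

Lemma moderateD x y : net_moderate rho x -> net_moderate rho y ->
  net_moderate rho (x + y).
Proof.
move=> /moderateP[k [N [k0 N0 xk]]] /moderateP[l [M [l0 M0 yl]]].
apply/moderateP; exists (k + l), (N + M); split; rewrite ?addr_gt0//.
near=> e.
have r0 : 0 < rho e by near: e; exact: gauge_gt0.
have r1 : rho e < 1 by near: e; exact: gauge_lt.
have r01 : 0 < rho e <= 1 by rewrite r0 ltW.
rewrite /= (le_trans (ler_normD _ _))// mulrDl lerD//.
  apply: (@le_trans _ _ (k * rho e `^ (- N))); first by near: e.
  by rewrite ler_pM2l// ger_powR// lerN2 lerDl ltW.
apply: (@le_trans _ _ (l * rho e `^ (- M))); first by near: e.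
by rewrite ler_pM2l// ger_powR// lerN2 lerDr ltW.
Unshelve. all: by end_near. Qed.

Lemma moderateN x : net_moderate rho x -> net_moderate rho (- x).
Proof. by apply: moderate_le; near=> e; rewrite normrN. Unshelve. all: by end_near. Qed.

Lemma moderateM x y : net_moderate rho x -> net_moderate rho y ->
  net_moderate rho (x * y).
Proof.
move=> /moderateP[k [N [k0 N0 xk]]] /moderateP[l [M [l0 M0 yl]]].
apply/moderateP; exists (k * l), (N + M); split; rewrite ?addr_gt0 ?mulr_gt0//.
near=> e.
have r0 : 0 < rho e by near: e; exact: gauge_gt0.
rewrite /= normrM opprD powRD ?(gt_eqF r0) ?implybT// mulrACA ler_pM//; near: e.
  exact: xk.
exact: yl.
Unshelve. all: by end_near. Qed.

Lemma net_negligible0 : net_negligible rho 0.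
Proof.
apply/negligibleP => N N0; exists 1 => //; near=> e.
by rewrite normr0 mul1r powR_ge0.
Unshelve. all: by end_near. Qed.

Lemma negligibleD x y : net_negligible rho x -> net_negligible rho y ->
  net_negligible rho (x + y).
Proof.
move=> /negligibleP xn /negligibleP yn; apply/negligibleP => N N0.
have [k k0 xk] := xn N N0; have [l l0 yl] := yn N N0.
exists (k + l); first exact: addr_gt0.
near=> e; rewrite /= (le_trans (ler_normD _ _))// mulrDl lerD//; near: e.
  exact: xk.
exact: yl.
Unshelve. all: by end_near. Qed.

Lemma negligibleMl x y : net_moderate rho x -> net_negligible rho y ->
  net_negligible rho (x * y).
Proof.
move=> /moderateP[k [M [k0 M0 xk]]] /negligibleP yn; apply/negligibleP => N N0.
have [l l0 yl] := yn _ (addr_gt0 M0 N0).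
exists (k * l); first exact: mulr_gt0.
near=> e.
have r0 : 0 < rho e by near: e; exact: gauge_gt0.
have -> : rho e `^ N = rho e `^ (- M) * rho e `^ (M + N).
  by rewrite -powRD ?(gt_eqF r0) ?implybT// addKr.
rewrite /= normrM mulrACA ler_pM//; near: e.
  exact: xk.
exact: yl.
Unshelve. all: by end_near. Qed.

Lemma not_negligible1 : ~ net_negligible rho 1.
Proof.
move=> /negligibleP/(_ 1 ltr01)[k k0 h].
have [e [+ [r0 rk]]] : exists e, 1 <= k * rho e `^ 1 /\ 0 < rho e /\ rho e < k^-1.
  apply: (@filter_ex _ (0^'+ : set_system R)); near=> e; split.
    by rewrite -[1 in X in X <= _]normr1; near: e.
  split; near: e; first exact: gauge_gt0.
  by apply: gauge_lt; rewrite invr_gt0.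
rewrite (powRr1 (ltW r0)) leNgt => /negP; apply.
by rewrite -(ltr_pM2l k0) mulfV ?gt_eqF// in rk.
Unshelve. all: by end_near. Qed.

End NetFacts.

Section GeneralizedNumbers.
Context {R : realType} (rho : asymptotic_gauge R).

Definition moderate_pred : {pred R -> R} := fun x => `[< net_moderate rho x >].

Lemma moderate_subring : subring_closed moderate_pred.
Proof.
split=> [|x y /asboolP xm /asboolP ym|x y /asboolP xm /asboolP ym]; apply/asboolP.
- exact: moderate_cst.
- by apply: moderateD => //; exact: moderateN.
- exact: moderateM.
Qed.

HB.instance Definition _ :=
  GRing.isSubringClosed.Build (R -> R) moderate_pred moderate_subring.

Record mnet := MNet { mnet_val :> R -> R; _ : mnet_val \in moderate_pred }.

HB.instance Definition _ := [isSub for mnet_val].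
HB.instance Definition _ := [Choice of mnet by <:].
HB.instance Definition _ := [SubChoice_isSubComNzRing of mnet by <:].

Definition negligible_pred : {pred mnet} := fun x => `[< net_negligible rho (val x) >].

Lemma negligible_idealr : idealr_closed negligible_pred.
Proof.
split=> [||x y z /asboolP yn /asboolP zn].
- by apply/asboolP; rewrite rmorph0; exact: net_negligible0.
- by apply/negP => /asboolP; rewrite rmorph1; exact: not_negligible1.
- apply/asboolP; rewrite rmorphD rmorphM; apply: negligibleD => //.
  by apply: negligibleMl => //; have /asboolP := valP x.
Qed.

HB.instance Definition _ := isIdealr.Build mnet negligible_pred negligible_idealr.

Definition gnum := {ideal_quot negligible_pred}.
HB.instance Definition _ := GRing.ComNzRing.on gnum.

End GeneralizedNumbers.

Section Points.
Context {R : realType} {rho : asymptotic_gauge R}.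
Local Notation Rt := (gnum rho).

(* 0 when x is not moderate; only used through [represents] or on nets built from
   representatives of generalized numbers. *)
Definition gclass (x : R -> R) : Rt := \pi_Rt (insubd (0 : mnet rho) x).

Definition represents (x : R -> R) (X : Rt) : Prop :=
  net_moderate rho x /\ X = gclass x.

Definition grepr (X : Rt) : R -> R := val (repr X).

Lemma gclass_eq (x y : R -> R) : net_moderate rho x -> net_moderate rho y ->
  gclass x = gclass y <-> net_negligible rho (x - y).
Proof.
move=> xm ym; have xP : x \in moderate_pred rho by exact/asboolP.
have yP : y \in moderate_pred rho by exact/asboolP.
rewrite /gclass.
have xyE : val (insubd (0 : mnet rho) x - insubd 0 y) = x - y.
  by rewrite rmorphB /= !insubdK.
rewrite -xyE; split=> [/eqP|xy].
  by rewrite eqmodE => /asboolP.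
by apply/eqP; rewrite eqmodE; exact/asboolP.
Qed.

Lemma grepr_represents (X : Rt) : represents (grepr X) X.
Proof.
have Xm : val (repr X) \in moderate_pred rho by exact: valP.
by split; [exact/asboolP|rewrite /gclass valKd reprK].
Qed.

(* The elements of \tilde R ^ n are rows over \tilde R; gvec_eq and
   gvec_surj identify these with classes of moderate nets in R^n. *)
Definition gvec n (x : R -> 'rV[R]_n) : 'rV[Rt]_n :=
  \row_i gclass (fun e => x e 0 i).

Definition vrepresents n (x : R -> 'rV[R]_n) (X : 'rV[Rt]_n) : Prop :=
  vnet_moderate rho x /\ X = gvec x.

Lemma enorm_coord n (x : 'rV[R]_n) i : `|x 0 i| <= enorm x.
Proof.
rewrite -sqrtr_sqr ler_wsqrtr// (bigD1 i)//= lerDl sumr_ge0// => j _.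
exact: sqr_ge0.
Qed.

Lemma enorm_sum n (x : 'rV[R]_n) : enorm x <= \sum_i `|x 0 i|.
Proof.
have h (s : seq 'I_n) : \sum_(i <- s) x 0 i ^+ 2 <= (\sum_(i <- s) `|x 0 i|) ^+ 2.
  elim: s => [|i s ih]; first by rewrite !big_nil expr0n.
  rewrite !big_cons sqrrD -[x 0 i ^+ 2]real_normK ?num_real// -addrA lerD2l.
  by rewrite (le_trans ih)// lerDr mulrn_wge0// mulr_ge0// sumr_ge0.
by rewrite -[leRHS]ger0_norm ?sumr_ge0// -sqrtr_sqr ler_wsqrtr// h.
Qed.

Lemma enorm_ge0 n (x : 'rV[R]_n) : 0 <= enorm x. Proof. exact: sqrtr_ge0. Qed.

Lemma vmoderateP n (x : R -> 'rV[R]_n) :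
  vnet_moderate rho x <-> forall i, net_moderate rho (fun e => x e 0 i).
Proof.
split=> [xm i|xm].
  apply: moderate_le xm; near=> e.
  by rewrite [leRHS]ger0_norm ?enorm_ge0// enorm_coord.
apply: (@moderate_le _ _ _ (\sum_i (fun e => `|x e 0 i|))).
  near=> e; rewrite fct_sumE [leRHS]ger0_norm ?sumr_ge0//.
  by rewrite ger0_norm ?enorm_ge0// enorm_sum.
apply: (big_ind (net_moderate rho)); first exact: moderate_cst.
  by move=> *; exact: moderateD.
by move=> i _; apply: moderate_le (xm i); near=> e; rewrite normr_id.
Unshelve. all: by end_near. Qed.

Lemma vnegligibleP n (x : R -> 'rV[R]_n) :
  vnet_negligible rho x <-> forall i, net_negligible rho (fun e => x e 0 i).
Proof.
split=> [xm i|xm].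
  apply: negligible_le xm; near=> e.
  by rewrite [leRHS]ger0_norm ?enorm_ge0// enorm_coord.
apply: (@negligible_le _ _ _ (\sum_i (fun e => `|x e 0 i|))).
  near=> e; rewrite fct_sumE [leRHS]ger0_norm ?sumr_ge0//.
  by rewrite ger0_norm ?enorm_ge0// enorm_sum.
apply: (big_ind (net_negligible rho)); first exact: net_negligible0.
  by move=> *; exact: negligibleD.
by move=> i _; apply: negligible_le (xm i); near=> e; rewrite normr_id.
Unshelve. all: by end_near. Qed.

Lemma gvec_eq n (x y : R -> 'rV[R]_n) : vnet_moderate rho x -> vnet_moderate rho y ->
  gvec x = gvec y <-> vnet_negligible rho (fun e => x e - y e).
Proof.
move=> /vmoderateP xm /vmoderateP ym; split=> [/rowP xy|/vnegligibleP xy].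
  apply/vnegligibleP => i; have := xy i; rewrite !mxE => /gclass_eq.
  by move=> /(_ (xm i) (ym i)); apply: negligible_le; near=> e; rewrite !mxE.
apply/rowP => i; rewrite !mxE; apply/gclass_eq => //.
by apply: negligible_le (xy i); near=> e; rewrite !mxE.
Unshelve. all: by end_near. Qed.

Lemma gvec_surj n (X : 'rV[Rt]_n) : exists x, vrepresents x X.
Proof.
exists (fun e => \row_i grepr (X 0 i) e); split.
  apply/vmoderateP => i.
  by apply: moderate_le (grepr_represents (X 0 i)).1; near=> e; rewrite mxE.
apply/rowP => i; rewrite mxE [LHS](grepr_represents (X 0 i)).2; congr gclass.
by apply/funext => e; rewrite mxE.
Unshelve. all: by end_near. Qed.

Definition gle (X Y : Rt) : Prop := exists x y,
  [/\ represents x X, represents y Y & forall e, I0 e -> x e <= y e].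

Definition glt (X Y : Rt) : Prop := gle 0 (Y - X) /\ exists Z, Z * (Y - X) = 1.

Definition gabs (X : Rt) : Rt := gclass (fun e => `|grepr X e|).

Definition gmax (X Y : Rt) : Rt :=
  gclass (fun e => Num.max (grepr X e) (grepr Y e)).

Definition gvnorm n (X : 'rV[Rt]_n) : Rt :=
  gclass (fun e => enorm (\row_i grepr (X 0 i) e)).

Definition gitv (a b : Rt) : set Rt := [set X | gle a X /\ gle X b].

Definition sharp_interior n (X : set 'rV[Rt]_n) : set 'rV[Rt]_n :=
  [set x | exists2 r : Rt, glt 0 r & forall y, glt (gvnorm (y - x)) r -> X y].

End Points.

Notation "x <=~ y" := (gle x y) (at level 70, y at next level).
Notation "x <~ y" := (glt x y) (at level 70, y at next level).

(* \partial_(i1) ... \partial_(ik) f for s = [:: i1; ...; ik]: multi-indices are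
   written as the list of the coordinates to differentiate along; for smooth f
   the order of the list is immaterial. *)
Definition partials {R : realType} n k (s : seq 'I_n) (f : 'rV[R]_n -> 'rV[R]_k) :
    'rV[R]_n -> 'rV[R]_k :=
  foldr (fun i g => fun x => 'D_(delta_mx 0 i) g x) f s.

(* D is meant to be open: f has (Frechet) derivatives of all orders on D, stated
   coordinatewise. *)
Definition smooth_on {R : realType} n k (D : set 'rV[R]_n)
    (f : 'rV[R]_n -> 'rV[R]_k) : Prop :=
  forall s x, D x -> differentiable (partials s f) x.

Section GeneralizedSmoothFunctions.
Context {R : realType} {rho : asymptotic_gauge R}.
Local Notation Rt := (gnum rho).

(* Written \langle \Omega_\epsilon \rangle. *)
Definition strong_internal n (Om : R -> set 'rV[R]_n) : set 'rV[Rt]_n :=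
  [set X | forall x, vrepresents x X -> \forall e \near 0^'+, Om e (x e)].

(* Maps on X are encoded as total functions, of which only the values on X
   matter. *)
Definition gsf_net n k (Om : R -> set 'rV[R]_n)
    (fe : R -> 'rV[R]_n -> 'rV[R]_k)
    (X : set 'rV[Rt]_n) (f : 'rV[Rt]_n -> 'rV[Rt]_k) : Prop :=
  [/\ forall e, I0 e -> open (Om e) /\ smooth_on (Om e) (fe e),
      X `<=` strong_internal Om,
      forall xe x, X x -> vrepresents xe x ->
        vrepresents (fun e => fe e (xe e)) (f x)
    & forall s xe x, X x -> vrepresents xe x ->
        vnet_moderate rho (fun e => partials s (fe e) (xe e))].

Definition gsf n k (X : set 'rV[Rt]_n) (f : 'rV[Rt]_n -> 'rV[Rt]_k) : Prop :=
  exists Om fe, gsf_net Om fe X f.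

Definition net_partial n k (X : set 'rV[Rt]_n) (s : seq 'I_n)
    (f : 'rV[Rt]_n -> 'rV[Rt]_k) (x : 'rV[Rt]_n) (L : 'rV[Rt]_k) : Prop :=
  exists Om fe xe, [/\ gsf_net Om fe X f, vrepresents xe x
    & vrepresents (fun e => partials s (fe e) (xe e)) L].

(* The sharp limit at x of the partial derivative along the interior of X. At the
   endpoints of [a, b] this is the one-sided limit; [a, b] also has points that
   are neither interior nor endpoints, which are treated in the same way. *)
Definition limit_partial n k (X : set 'rV[Rt]_n) (s : seq 'I_n)
    (f : 'rV[Rt]_n -> 'rV[Rt]_k) (x : 'rV[Rt]_n) (L : 'rV[Rt]_k) : Prop :=
  forall r : Rt, 0 <~ r -> exists2 q : Rt, 0 <~ q &
    forall y M, sharp_interior X y -> gvnorm (y - x) <~ q ->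
      net_partial X s f y M -> gvnorm (M - L) <~ r.

Definition gpartial n k (X : set 'rV[Rt]_n) (s : seq 'I_n)
    (f : 'rV[Rt]_n -> 'rV[Rt]_k) (x : 'rV[Rt]_n) : 'rV[Rt]_k :=
  xget 0 [set L | (sharp_interior X x /\ net_partial X s f x L) \/
                  (~ sharp_interior X x /\ limit_partial X s f x L)].

(* Functions of one generalized variable are functions on \tilde R ^ 1. *)
Definition gline (X : set Rt) : set 'rV[Rt]_1 := [set x | X (x 0 0)].

Definition on_gline k (f : Rt -> 'rV[Rt]_k) : 'rV[Rt]_1 -> 'rV[Rt]_k :=
  fun x => f (x 0 0).

Definition gsf1 k (X : set Rt) (f : Rt -> 'rV[Rt]_k) : Prop :=
  gsf (gline X) (on_gline f).

Definition gderiv k (X : set Rt) (m : nat) (f : Rt -> 'rV[Rt]_k) (t : Rt) :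
    'rV[Rt]_k :=
  gpartial (gline X) (nseq m 0) (on_gline f) (const_mx t).

Definition scalar_fun (f : Rt -> Rt) : Rt -> 'rV[Rt]_1 := fun t => const_mx (f t).

Definition gint (a b : Rt) (f : Rt -> Rt) : Rt :=
  xget 0 [set J | exists Om fe ae be,
    [/\ gsf_net Om fe (gline (gitv a b)) (on_gline (scalar_fun f)),
        represents ae a, represents be b
      & represents (fun e => \int[lebesgue_measure]_(t in `[ae e, be e])
                               fe e (const_mx t) 0 0) J]].

End GeneralizedSmoothFunctions.

Section Variations.
Context {R : realType} {rho : asymptotic_gauge R} (d : nat).
Local Notation Rt := (gnum rho).
Local Notation Rtd := 'rV[Rt]_d.

Definition lagrangian (a b : Rt) (F : Rt -> Rtd -> Rtd -> Rt) : Prop :=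
  gsf [set x : 'rV[Rt]_(1 + (d + d)) | gitv a b (lsubmx x 0 0)]
      (fun x => const_mx (F (lsubmx x 0 0) (lsubmx (rsubmx x)) (rsubmx (rsubmx x)))
         : 'rV[Rt]_1).

Definition gaction (a b : Rt) (F : Rt -> Rtd -> Rtd -> Rt) (u : Rt -> Rtd) : Rt :=
  gint a b (fun t => F t (u t) (gderiv (gitv a b) 1 u t)).

Definition gsf0 (a b : Rt) : set (Rt -> Rtd) :=
  [set eta | [/\ gsf1 setT eta, eta a = 0 & eta b = 0]].

Definition gsf_bd (a b : Rt) (p q : Rtd) : set (Rt -> Rtd) :=
  [set v | [/\ gsf1 (gitv a b) v, v a = p & v b = q]].

Definition gargmax (a b : Rt) (g : Rt -> Rt) : Rt :=
  xget 0 [set M | gitv a b M /\ forall t, gitv a b t -> g t <=~ g M].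

Definition gargmin (a b : Rt) (g : Rt -> Rt) : Rt :=
  xget 0 [set M | gitv a b M /\ forall t, gitv a b t -> g M <=~ g t].

(* The initial value 0 of the iterated maxima is harmless: all terms are
   absolute values. *)
Definition Cnorm (a b : Rt) (m : nat) (v : Rt -> Rtd) : Rt :=
  \big[gmax/0]_(k < m.+1) \big[gmax/0]_(i < d)
    let vki := fun t => gderiv (gitv a b) k v t 0 i in
    gmax (gabs (vki (gargmax a b vki))) (gabs (vki (gargmin a b vki))).

Definition Cball (a b : Rt) (m : nat) (r : Rt) (u : Rt -> Rtd) :
    set (Rt -> Rtd) :=
  [set v | gsf1 (gitv a b) v /\ Cnorm a b m (fun t => v t - u t) <~ r].

Definition local_minimizer (a b : Rt) (I : (Rt -> Rtd) -> Rt) (p q : Rtd)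
    (u : Rt -> Rtd) : Prop :=
  gsf_bd a b p q u /\
  exists (r : Rt) (m : nat), 0 <~ r /\
    forall v, Cball a b m r u v -> gsf_bd a b p q v -> I u <=~ I v.

Definition gvariation (m : nat) (I : (Rt -> Rtd) -> Rt) (u eta : Rt -> Rtd) : Rt :=
  gderiv setT m (scalar_fun (fun s => I (fun t => u t + s *: eta t))) 0 0 0.

End Variations.

(* Main.v *)
(* Minimality is used only through I(u + s eta) >= I(u) for infinitesimal s.

   On [a, b] the k-th derivative of a generalized smooth function is represented by
   the k-th derivatives of any net defining it: two such nets differ by a negligible
   net, and the derivatives of a uniformly negligible net whose derivatives are
   moderate are negligible (mean value theorem with step rho^P, P large). At points
   that are not sharply interior the limit is computed by continuity and density of
   the interior points. The extreme value theorem for the nets then shows that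
   the extrema in the norms are attained, so that ||s eta||_m <= |s| rho^-n for some
   n, and u + s eta lies in the ball of the local minimizer for s = +-rho^N, N large.

   Finally, if phi(+-rho^N) >= phi(0) for all large N, comparing a net of phi at 0 and
   at +-rho^N by the mean value theorem, once to first and once to second order, gives
   phi'(0) = 0 and phi''(0) >= 0. *)

Require Import Defs.
From mathcomp Require Import all_boot all_order all_algebra.
From mathcomp Require Import generic_quotient ring_quotient.
From mathcomp Require Import all_classical all_reals all_analysis.
From mathcomp Require Import ring lra zify.

Set Implicit Arguments.
Unset Strict Implicit.
Unset Printing Implicit Defensive.
Import Order.TTheory GRing.Theory Num.Theory.
Import numFieldNormedType.Exports.

Local Open Scope classical_set_scope.
Local Open Scope ring_scope.

(** * Moderate and negligible nets *)

Section Nets.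
Context {R : realType} (rho : asymptotic_gauge R).
Implicit Types x y : R -> R.

(** The radius [r] of the ball may be infinitesimal, so that no nonzero real step [s] is admissible;
    this is why the test values are powers of rho. An inequality between classes holds for nets only
    up to rho^n, for each [n] separately. Dividing by the step magnifies this error by rho^-N, and
    by rho^-2N to second order; so [N] is fixed first and the error exponent afterwards. A second
    obstacle is that [gderiv] and the extremal points are selected by [xget], whose default value
    carries no information. Existence and uniqueness of derivative values on [a, b], and existence
    of extrema, must therefore precede any estimate of the norms. *)

Lemma gauge_small (c : R) : 0 < c -> \forall e \near 0^'+, 0 < rho e < c.
Proof.
move=> c0; near=> e; apply/andP; split; near: e; first exact: gauge_gt0.
exact: gauge_lt.
Unshelve. all: by end_near. Qed.

Lemma near_I0 : \forall e \near (0 : R)^'+, I0 e.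
Proof.
by near=> e; apply/andP; split; near: e; [exact: nbhs_right_gt|exact: nbhs_right_le].
Unshelve. all: by end_near. Qed.

(** A constant [k] is absorbed by one more power, since k rho <= 1 for small [e]. Without constants,
    estimates become comparisons of integer powers of rho. *)
Lemma negligible_natP x : net_negligible rho x <->
  forall n, \forall e \near 0^'+, `|x e| <= rho e ^+ n.
Proof.
split=> [/Defs.negligibleP xn n|xn].
  have [k k0 xk] := xn n.+1%:R (ltr0Sn _ _).
  have kV : 0 < k^-1 by rewrite invr_gt0.
  near=> e; have /andP[r0 rk] : 0 < rho e < k^-1 by near: e; exact: gauge_small.
  apply: (@le_trans _ _ (k * rho e `^ n.+1%:R)); first by near: e.
  have kr : k * rho e <= 1 by rewrite -ler_pdivlMl// mulr1 ltW.
  by rewrite powR_mulrn ?(ltW r0)// exprS mulrA ler_piMl ?exprn_ge0 ?(ltW r0).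
apply/Defs.negligibleP => N N0; exists 1 => //.
have [n Nn] : exists n : nat, N <= n%:R.
  by exists (Num.bound N); rewrite ltW// archi_boundP// ltW.
near=> e; have /andP[r0 r1] : 0 < rho e < 1 by near: e; exact: gauge_small.
rewrite mul1r; apply: (@le_trans _ _ (rho e ^+ n)); first by near: e; exact: xn.
by rewrite -powR_mulrn ?(ltW r0)// ger_powR ?r0 ?(ltW r1).
Unshelve. all: by end_near. Qed.

(** The product form avoids negative powers; the successor in the exponent absorbs the constant
    [k]. *)
Lemma moderate_natP x : net_moderate rho x <->
  exists n, \forall e \near 0^'+, `|x e| * rho e ^+ n <= 1.
Proof.
split=> [/moderateP[k [N [k0 N0 xk]]]|[n xn]].
  have kV : 0 < k^-1 by rewrite invr_gt0.
  exists (Num.bound N).+1; near=> e.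
  have /andP[r0 r1] : 0 < rho e < 1 by near: e; exact: gauge_small.
  have rk : rho e < k^-1 by near: e; exact: gauge_lt.
  apply: (@le_trans _ _ (k * rho e `^ (- N) * rho e ^+ (Num.bound N).+1)).
    by rewrite ler_wpM2r ?exprn_ge0 ?(ltW r0)//; near: e.
  have rN : rho e ^+ Num.bound N <= rho e `^ N.
    by rewrite -powR_mulrn ?(ltW r0)// ger_powR ?r0 ?(ltW r1)// ltW// archi_boundP// ltW.
  have kr : k * rho e <= 1 by rewrite -ler_pdivlMl// mulr1 ltW.
  have rN0 : 0 < rho e `^ N by rewrite powR_gt0.
  rewrite powRN exprS mulrACA mulr_ile1 ?mulr_ge0 ?invr_ge0 ?exprn_ge0//;
    rewrite ?(ltW r0) ?(ltW k0) ?(ltW rN0)//.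
  by rewrite ler_pdivrMl// mulr1.
apply/moderateP; exists 1, n.+1%:R; split=> //.
near=> e; have /andP[r0 r1] : 0 < rho e < 1 by near: e; exact: gauge_small.
rewrite mul1r powRN powR_mulrn ?(ltW r0)// -[leRHS]mul1r ler_pdivlMr ?exprn_gt0//.
apply: (@le_trans _ _ (`|x e| * rho e ^+ n)); last by near: e.
by rewrite ler_wpM2l// exprS ler_piMl ?exprn_ge0 ?(ltW r0) ?(ltW r1).
Unshelve. all: by end_near. Qed.

Lemma negligible_moderate x : net_negligible rho x -> net_moderate rho x.
Proof.
move=> /negligible_natP/(_ 0) x1; apply/moderate_natP; exists 0.
by near=> e; rewrite expr0 mulr1; near: e.
Unshelve. all: by end_near. Qed.

Lemma negligible_near x y : (\forall e \near 0^'+, x e = y e) ->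
  net_negligible rho x -> net_negligible rho y.
Proof. by move=> xy; apply: negligible_le; near=> e; rewrite (near xy).
Unshelve. all: by end_near. Qed.

Lemma moderate_near x y : (\forall e \near 0^'+, x e = y e) ->
  net_moderate rho x -> net_moderate rho y.
Proof. by move=> xy; apply: moderate_le; near=> e; rewrite (near xy).
Unshelve. all: by end_near. Qed.

Lemma moderate_gaugeX n : net_moderate rho (fun e => rho e ^+ n).
Proof.
apply/moderate_natP; exists 0; near=> e.
have /andP[r0 r1] : 0 < rho e < 1 by near: e; exact: gauge_small.
by rewrite expr0 mulr1 normrX gtr0_norm// exprn_ile1 ?(ltW r0) ?(ltW r1).
Unshelve. all: by end_near. Qed.

Lemma moderate_between x y z : (\forall e \near 0^'+, x e <= z e <= y e) ->
  net_moderate rho x -> net_moderate rho y -> net_moderate rho z.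
Proof.
move=> xzy xm ym.
apply: (@moderate_le _ _ _ ((fun e => `|x e|) + (fun e => `|y e|))).
  near=> e; have /andP[xz zy] : x e <= z e <= y e by near: e.
  rewrite /= [leRHS]ger0_norm ?addr_ge0// ler_norml !fctE.
  have := ler_norm (y e); have := ler_norm (- x e); rewrite normrN.
  have := normr_ge0 (x e); have := normr_ge0 (y e).
  by move=> *; apply/andP; split; lra.
by apply: moderateD; [apply: moderate_le xm|apply: moderate_le ym];
  near=> e; rewrite normr_id.
Unshelve. all: by end_near. Qed.

End Nets.

(** * Order and arithmetic of generalized numbers through representatives *)

Section Classes.
Context {R : realType} {rho : asymptotic_gauge R}.
Local Notation Rt := (gnum rho).
Implicit Types (x y : R -> R) (X Y Z : Rt).

Lemma represents_gclass x : net_moderate rho x -> represents x (gclass x : Rt).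
Proof. by []. Qed.

Lemma represents_sub x y X Y : represents x X -> represents y Y ->
  represents (fun e => x e - y e) (X - Y).
Proof.
move=> [xm ->] [ym ->]; have xP : x \in moderate_pred rho by exact/asboolP.
have yP : y \in moderate_pred rho by exact/asboolP.
have xym : net_moderate rho (x - y) by apply: moderateD => //; exact: moderateN.
have xyP : x - y \in moderate_pred rho by exact/asboolP.
split=> //; rewrite /gclass -(@rmorphB _ _ (\pi_Rt)%qT); congr (\pi_Rt)%qT.
by apply: val_inj; rewrite rmorphB /= !insubdK.
Qed.

Lemma represents_mul x y X Y : represents x X -> represents y Y ->
  represents (fun e => x e * y e) (X * Y).
Proof.
move=> [xm ->] [ym ->]; have xP : x \in moderate_pred rho by exact/asboolP.
have yP : y \in moderate_pred rho by exact/asboolP.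
have xym : net_moderate rho (x * y) by exact: moderateM.
have xyP : x * y \in moderate_pred rho by exact/asboolP.
split=> //; rewrite /gclass -(@rmorphM _ _ (\pi_Rt)%qT); congr (\pi_Rt)%qT.
by apply: val_inj; rewrite rmorphM /= !insubdK.
Qed.

Lemma represents0 : represents (fun=> 0) (0 : Rt).
Proof.
have xP : (fun=> 0) \in moderate_pred rho by exact/asboolP/moderate_cst.
split; first exact: moderate_cst.
rewrite /gclass -(@rmorph0 _ _ (\pi_Rt)%qT); congr (\pi_Rt)%qT.
by apply: val_inj; rewrite rmorph0 /= !insubdK.
Qed.

Lemma represents1 : represents (fun=> 1) (1 : Rt).
Proof.
have xP : (fun=> 1) \in moderate_pred rho by exact/asboolP/moderate_cst.
split; first exact: moderate_cst.
rewrite /gclass -(@rmorph1 _ _ (\pi_Rt)%qT); congr (\pi_Rt)%qT.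
by apply: val_inj; rewrite rmorph1 /= !insubdK.
Qed.

Lemma represents_opp x X : represents x X -> represents (fun e => - x e) (- X).
Proof.
move=> /(represents_sub represents0); rewrite sub0r.
by under eq_fun do rewrite sub0r.
Qed.

Lemma represents_add x y X Y : represents x X -> represents y Y ->
  represents (fun e => x e + y e) (X + Y).
Proof.
move=> xX /represents_opp/(represents_sub xX); rewrite opprK.
by under eq_fun do rewrite opprK.
Qed.

Lemma represents_eq x y X : represents x X -> represents y X ->
  net_negligible rho (x - y).
Proof. by move=> [xm ->] [ym /gclass_eq]; exact. Qed.

Lemma represents_inj x X Y : represents x X -> represents x Y -> X = Y.
Proof. by move=> [_ ->] [_ ->]. Qed.

Lemma represents_negligible x y X : represents x X ->
  net_negligible rho (x - y) -> represents y X.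
Proof.
move=> [xm ->] xy; have ym : net_moderate rho y.
  have := moderateD xm (moderateN (negligible_moderate xy)).
  by congr net_moderate; apply/funext => e; rewrite /= !fctE; ring.
by split=> //; apply/gclass_eq.
Qed.

Lemma represents_near x y X : (\forall e \near 0^'+, x e = y e) ->
  represents x X -> represents y X.
Proof.
move=> xy xX; apply: represents_negligible xX _.
apply: (@negligible_near _ _ 0); last exact: net_negligible0.
by near=> e; rewrite !fctE (near xy)// subrr.
Unshelve. all: by end_near. Qed.

Lemma represents_close x y X Y : represents x X -> represents y Y ->
  (forall n, \forall e \near 0^'+, `|x e - y e| <= rho e ^+ n) -> X = Y.
Proof.
move=> xX yY xy; apply: (represents_inj _ yY).
by apply: represents_negligible xX _; apply/negligible_natP.
Qed.

(** The order is defined through some pair of ordered representatives; the slack rho^n makes the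
    criterion valid for every pair. *)
Lemma gleP x y X Y : represents x X -> represents y Y ->
  X <=~ Y <-> forall n, \forall e \near 0^'+, x e <= y e + rho e ^+ n.
Proof.
move=> xX yY; split=> [[x' [y' [x'X y'Y x'y']]] n|xy].
  (* Two errors rho^(n+1) add up to at most rho^n once rho < 1/2. *)
  have /negligible_natP/(_ n.+1) nx := represents_eq xX x'X.
  have /negligible_natP/(_ n.+1) ny := represents_eq yY y'Y.
  near=> e; have /andP[r0 r1] : 0 < rho e < 2^-1.
    by near: e; apply: gauge_small; rewrite invr_gt0.
  have : x' e <= y' e.
    by apply: x'y'; near: e; exact: near_I0.
  have : `|x e - x' e| <= rho e ^+ n.+1 by near: e.
  have : `|y e - y' e| <= rho e ^+ n.+1 by near: e.
  rewrite exprS; have : 0 < rho e ^+ n by rewrite exprn_gt0.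
  move: (rho e ^+ n) => s s0; have : rho e * s <= 2^-1 * s by rewrite ler_wpM2r// ltW.
  by rewrite !ler_norml => ? /andP[? ?] /andP[? ?]; lra.
(* Lowering [x] to the minimum changes it by at most rho^n for each [n], hence keeps its class. *)
exists (fun e => Num.min (x e) (y e)), y; split=> //; last first.
  by move=> e _; rewrite ge_min lexx orbT.
apply: represents_negligible xX _; apply/negligible_natP => n.
near=> e; have : x e <= y e + rho e ^+ n by near: e.
have /andP[r0 _] : 0 < rho e < 1 by near: e; exact: gauge_small.
have : 0 < rho e ^+ n by rewrite exprn_gt0.
rewrite /= !fctE; case: (leP (x e) (y e)) => xye n0 xyn.
  by rewrite subrr normr0 ltW.
by rewrite gtr0_norm ?subr_gt0//; lra.
Unshelve. all: by end_near. Qed.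

Lemma gle_near x y X Y : represents x X -> represents y Y ->
  (\forall e \near 0^'+, x e <= y e) -> X <=~ Y.
Proof.
move=> xX yY xy; apply/(gleP xX yY) => n; near=> e.
have /andP[r0 _] : 0 < rho e < 1 by near: e; exact: gauge_small.
by rewrite (@le_trans _ _ (y e)) ?lerDl ?exprn_ge0 ?(ltW r0)//; near: e.
Unshelve. all: by end_near. Qed.

(** An inverse is moderate, so invertibility bounds the gap below by a power of rho; conversely,
    such a gap has a moderate inverse. *)
Lemma gltP x y X Y : represents x X -> represents y Y ->
  X <~ Y <-> exists n, \forall e \near 0^'+, x e + rho e ^+ n <= y e.
Proof.
move=> xX yY; have yxYX := represents_sub yY xX; split.
  move=> [/(gleP represents0 yxYX) yx [Z ZYX]].
  have zZ := grepr_represents Z.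
  have [/moderate_natP[m zm] _] := zZ.
  have := represents_eq (represents_mul zZ yxYX).
  rewrite {}ZYX => /(_ _ represents1)/negligible_natP/(_ 1) zyx.
  (* A gap below rho^(m+2) is less than rho^m / 4. Its product with [Z], of size at most rho^-m,
     would be at most 1/4, whereas it equals 1 up to rho < 1/2. *)
  exists m.+2; near=> e.
  have /andP[r0 r1] : 0 < rho e < 2^-1.
    by near: e; apply: gauge_small; rewrite invr_gt0.
  have h1 : `|grepr Z e * (y e - x e) - 1| <= rho e ^+ 1 by near: e.
  have h2 : `|grepr Z e| * rho e ^+ m <= 1 by near: e.
  have h3 : 0 <= (y e - x e) + rho e ^+ m.+2 by near: e; exact: yx.
  have s0 : 0 < rho e ^+ m by rewrite exprn_gt0.
  have s2 : rho e ^+ m.+2 < 4^-1 * rho e ^+ m.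
    rewrite !exprS mulrA ltr_pM2r//; nra.
  rewrite addrC -lerBrDr leNgt; apply/negP => h4.
  have h5 : `|y e - x e| <= rho e ^+ m.+2 by rewrite ler_norml; apply/andP; split; lra.
  have h6 : `|grepr Z e * (y e - x e)| <= 4^-1.
    rewrite normrM.
    have := ler_wpM2l (normr_ge0 (grepr Z e)) h5.
    have := ler_wpM2l (normr_ge0 (grepr Z e)) (ltW s2).
    by lra.
  by move: h1 h6; rewrite expr1 !ler_norml => /andP[? ?] /andP[? ?]; lra.
move=> [n xyn]; split.
  apply: (gle_near represents0 yxYX); near=> e.
  have /andP[r0 _] : 0 < rho e < 1 by near: e; exact: gauge_small.
  rewrite subr_ge0 (@le_trans _ _ (x e + rho e ^+ n)) ?lerDl ?exprn_ge0 ?(ltW r0)//.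
  by near: e.
have zm : net_moderate rho (fun e => (y e - x e)^-1).
  apply/moderate_natP; exists n; near=> e.
  have /andP[r0 _] : 0 < rho e < 1 by near: e; exact: gauge_small.
  have s0 : 0 < rho e ^+ n by rewrite exprn_gt0.
  have h : x e + rho e ^+ n <= y e by near: e.
  have yx0 : 0 < y e - x e by lra.
  by rewrite gtr0_norm ?invr_gt0// ler_pdivrMl// mulr1; lra.
exists (gclass (fun e => (y e - x e)^-1)).
apply: (represents_inj (represents_mul (represents_gclass zm) yxYX)).
apply: represents_near represents1; near=> e.
have /andP[r0 _] : 0 < rho e < 1 by near: e; exact: gauge_small.
have s0 : 0 < rho e ^+ n by rewrite exprn_gt0.
have h : x e + rho e ^+ n <= y e by near: e.
by rewrite mulVf// gt_eqF//; lra.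
Unshelve. all: by end_near. Qed.

Lemma gle_opp X Y X' Y' : X = - X' -> Y = - Y' -> X <=~ Y -> Y' <=~ X'.
Proof.
have xX := grepr_represents X'; have yY := grepr_represents Y'.
move=> -> -> /(gleP (represents_opp xX) (represents_opp yY)) h.
by apply/(gleP yY xX) => n; apply: filterS (h n) => e /=; lra.
Qed.

Lemma glt_near_le x y X Y : represents x X -> represents y Y -> X <~ Y ->
  \forall e \near 0^'+, x e <= y e.
Proof.
move=> xX yY /(gltP xX yY)[n xy]; near=> e.
have /andP[r0 _] : 0 < rho e < 1 by near: e; exact: gauge_small.
apply: (@le_trans _ _ (x e + rho e ^+ n)); last by near: e.
by rewrite lerDl exprn_ge0 ?(ltW r0).
Unshelve. all: by end_near. Qed.

Lemma gaugeX_represents n :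
  represents (fun e => rho e ^+ n) (gclass (fun e => rho e ^+ n) : Rt).
Proof. exact/represents_gclass/moderate_gaugeX. Qed.

Lemma gaugeX_gt0 n : 0 <~ (gclass (fun e => rho e ^+ n) : Rt).
Proof.
by apply/(gltP represents0 (gaugeX_represents n)); exists n; near=> e; rewrite add0r.
Unshelve. all: by end_near. Qed.

Lemma gle_lt_trans X Y Z : X <=~ Y -> Y <~ Z -> X <~ Z.
Proof.
have xX := grepr_represents X; have yY := grepr_represents Y.
have zZ := grepr_represents Z.
move=> /(gleP xX yY) xy /(gltP yY zZ)[n yz]; apply/(gltP xX zZ); exists n.+1.
near=> e; have /andP[r0 r1] : 0 < rho e < 2^-1.
  by near: e; apply: gauge_small; rewrite invr_gt0.
have : grepr X e <= grepr Y e + rho e ^+ n.+1 by near: e; exact: xy.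
have : grepr Y e + rho e ^+ n <= grepr Z e by near: e.
have : rho e ^+ n.+1 <= 2^-1 * rho e ^+ n.
  by rewrite exprS ler_wpM2r ?exprn_ge0 ?(ltW r0) ?(ltW r1).
by lra.
Unshelve. all: by end_near. Qed.

Lemma gabs_represents x X : represents x X -> represents (fun e => `|x e|) (gabs X).
Proof.
move=> xX; have yX := grepr_represents X; have [ym _] := yX.
have yay : represents (fun e => `|grepr X e|) (gabs X).
  by split=> //; apply: moderate_le ym; near=> e; rewrite normr_id.
apply: represents_negligible yay _; apply: negligible_le (represents_eq yX xX).
by near=> e; rewrite !fctE; exact: ler_dist_dist.
Unshelve. all: by end_near. Qed.

Lemma gmax_le X Y Z : X <=~ Z -> Y <=~ Z -> gmax X Y <=~ Z.
Proof.
have xX := grepr_represents X; have yY := grepr_represents Y.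
have zZ := grepr_represents Z.
have mM : represents (fun e => Num.max (grepr X e) (grepr Y e)) (gmax X Y).
  split=> //; apply: (@moderate_between _ _
      (fun e => - `|grepr X e| - `|grepr Y e|) (fun e => `|grepr X e| + `|grepr Y e|)).
  - near=> e; have := ler_norm (grepr X e); have := ler_norm (grepr Y e).
    have := ler_norm (- grepr X e); have := ler_norm (- grepr Y e).
    rewrite !normrN; have := normr_ge0 (grepr X e); have := normr_ge0 (grepr Y e).
    by move=> *; apply/andP; split; case: (leP (grepr X e)) => _; lra.
  - exact: (represents_sub (represents_opp (gabs_represents xX)) (gabs_represents yY)).1.
  - exact: (represents_add (gabs_represents xX) (gabs_represents yY)).1.
move=> /(gleP xX zZ) xz /(gleP yY zZ) yz; apply/(gleP mM zZ) => n.
by near=> e; rewrite ge_max; apply/andP; split; near: e.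
Unshelve. all: by end_near. Qed.

(** The representative of the point is kept and the endpoints give way, the correction being
    negligible. *)
Lemma gitv_between (a b t : Rt) x : gitv a b t -> represents x t ->
  exists ae be, [/\ represents ae a, represents be b
    & forall e, ae e <= x e <= be e].
Proof.
move=> [at_ tb] xt; have aa := grepr_represents a; have bb := grepr_represents b.
move: at_ tb => /(gleP aa xt) ax /(gleP xt bb) xb.
exists (fun e => Num.min (grepr a e) (x e)), (fun e => Num.max (grepr b e) (x e)); split.
- apply: represents_negligible aa _; apply/negligible_natP => n.
  near=> e; have : grepr a e <= x e + rho e ^+ n by near: e; exact: ax.
  have /andP[r0 _] : 0 < rho e < 1 by near: e; exact: gauge_small.
  have : 0 < rho e ^+ n by rewrite exprn_gt0.
  by rewrite /= !fctE ler_norml; case: (leP _ (x e)) => *; apply/andP; split; lra.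
- apply: represents_negligible bb _; apply/negligible_natP => n.
  near=> e; have : x e <= grepr b e + rho e ^+ n by near: e; exact: xb.
  have /andP[r0 _] : 0 < rho e < 1 by near: e; exact: gauge_small.
  have : 0 < rho e ^+ n by rewrite exprn_gt0.
  by rewrite /= !fctE ler_norml; case: (leP _ (x e)) => *; apply/andP; split; lra.
- by move=> e; rewrite ge_min le_max !lexx !orbT.
Unshelve. all: by end_near. Qed.

Lemma gitv_between2 (a b t s : Rt) x y : gitv a b t -> represents x t ->
  gitv a b s -> represents y s ->
  exists ae be, [/\ represents ae a, represents be b,
    forall e, ae e <= x e <= be e & forall e, ae e <= y e <= be e].
Proof.
move=> at_ xt as_ ys; have [ae [be [aea beb xab]]] := gitv_between at_ xt.
have [ae' [be' [aea' beb' yab]]] := gitv_between as_ ys.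
exists (fun e => Num.min (ae e) (ae' e)), (fun e => Num.max (be e) (be' e)); split.
- apply: (represents_negligible aea); apply: negligible_le (represents_eq aea aea').
  by near=> e; rewrite !fctE; case: (leP (ae e) (ae' e)) => // _; rewrite subrr normr0.
- apply: (represents_negligible beb); apply: negligible_le (represents_eq beb beb').
  by near=> e; rewrite !fctE; case: (leP (be e) (be' e)) => // _; rewrite subrr normr0.
- by move=> e; have /andP[? ?] := xab e; rewrite ge_min le_max; apply/andP; split;
    apply/orP; left.
- by move=> e; have /andP[? ?] := yab e; rewrite ge_min le_max; apply/andP; split;
    apply/orP; right.
Unshelve. all: by end_near. Qed.

Lemma gitv_represents (a b : Rt) ae be x : represents ae a -> represents be b ->
  (\forall e \near 0^'+, ae e <= x e <= be e) ->
  represents x (gclass x : Rt) /\ gitv a b (gclass x).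
Proof.
move=> aea beb axb; have xx : represents x (gclass x : Rt).
  by split=> //; exact: moderate_between axb aea.1 beb.1.
by split=> //; split; [apply: (gle_near aea xx)|apply: (gle_near xx beb)];
  apply: filterS axb => e /andP[].
Qed.

(** Dual to [gitv_between]: the endpoints are fixed and the point gives way, for use when a net has
    already been studied on [ae, be]. *)
Lemma gitv_clamp (a b y : Rt) ae be : represents ae a -> represents be b ->
  (\forall e \near 0^'+, ae e <= be e) -> gitv a b y ->
  exists2 ye, represents ye y & forall e, ae e <= be e -> ae e <= ye e <= be e.
Proof.
move=> aea beb ab [ay yb]; have yy := grepr_represents y.
move: ay yb => /(gleP aea yy) ay /(gleP yy beb) yb.
exists (fun e => Num.max (ae e) (Num.min (grepr y e) (be e))); last first.
  by move=> e abe; rewrite le_max lexx ge_max abe ge_min lexx orbT.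
apply: (represents_negligible yy); apply/negligible_natP => n.
near=> e; have : ae e <= grepr y e + rho e ^+ n by near: e; exact: ay.
have : grepr y e <= be e + rho e ^+ n by near: e; exact: yb.
have : ae e <= be e by near: e.
have /andP[r0 _] : 0 < rho e < 1 by near: e; exact: gauge_small.
have : 0 < rho e ^+ n by rewrite exprn_gt0.
rewrite /= !fctE ler_norml.
case: (leP (grepr y e) (be e)) => h1.
  by case: (leP (ae e) (grepr y e)) => h2 *; apply/andP; split; lra.
by case: (leP (ae e) (be e)) => h2 *; apply/andP; split; lra.
Unshelve. all: by end_near. Qed.

End Classes.

(** * Coordinatewise estimates for generalized vectors *)

Section VectorClasses.
Context {R : realType} {rho : asymptotic_gauge R}.
Local Notation Rt := (gnum rho).

Lemma vrepresentsP n (x : R -> 'rV[R]_n) (X : 'rV[Rt]_n) :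
  vrepresents x X <-> forall i, represents (fun e => x e 0 i) (X 0 i).
Proof.
split=> [[/vmoderateP xm ->] i|xX]; first by rewrite mxE; split.
split; first by apply/vmoderateP => i; have [] := xX i.
by apply/rowP => i; rewrite mxE; have [] := xX i.
Qed.

Lemma vrepresents0 n : vrepresents (fun=> 0) (0 : 'rV[Rt]_n).
Proof.
apply/vrepresentsP => i; rewrite !mxE; exact: represents0.
Qed.

Lemma vrepresents_add n x y (V W : 'rV[Rt]_n) : vrepresents x V -> vrepresents y W ->
  vrepresents (fun e => x e + y e) (V + W).
Proof.
move=> /vrepresentsP xX /vrepresentsP yY; apply/vrepresentsP => i; rewrite !mxE.
by under eq_fun do rewrite !mxE; exact: represents_add.
Qed.

Lemma vrepresents_scale n c (C : Rt) y (W : 'rV[Rt]_n) : represents c C ->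
  vrepresents y W -> vrepresents (fun e => c e *: y e) (C *: W).
Proof.
move=> cC /vrepresentsP yY; apply/vrepresentsP => i; rewrite !mxE.
by under eq_fun do rewrite !mxE; exact: represents_mul.
Qed.

Lemma vrepresents_sub n x y (X Y : 'rV[Rt]_n) : vrepresents x X -> vrepresents y Y ->
  vrepresents (fun e => x e - y e) (X - Y).
Proof.
move=> /vrepresentsP xX /vrepresentsP yY; apply/vrepresentsP => i; rewrite !mxE.
by under eq_fun do rewrite !mxE; exact: represents_sub.
Qed.

Lemma vrepresents_const (te : R -> R) (t : Rt) : represents te t ->
  vrepresents (fun e => const_mx (te e) : 'rV[R]_1) (const_mx t).
Proof.
move=> tet; apply/vrepresentsP => i; rewrite mxE.
by under eq_fun do rewrite mxE.
Qed.

Lemma vnet_moderate_near n (x y : R -> 'rV[R]_n) : (\forall e \near 0^'+, x e = y e) ->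
  vnet_moderate rho x -> vnet_moderate rho y.
Proof. by move=> xy; apply: moderate_near; apply: filterS xy => e ->. Qed.

Lemma scale_coord n (C : Rt) (V : 'rV[Rt]_n) i : (C *: V) 0 i = C * V 0 i.
Proof. by rewrite mxE. Qed.

Lemma gvnorm_represents n (X : 'rV[Rt]_n) :
  represents (fun e => enorm (\row_i grepr (X 0 i) e)) (gvnorm X).
Proof.
split=> //.
have : vnet_moderate rho (fun e => \row_i grepr (X 0 i) e).
  apply/vmoderateP => i; apply: moderate_le (grepr_represents (X 0 i)).1.
  by near=> e; rewrite mxE.
by [].
Unshelve. all: by end_near. Qed.

(** [gvnorm] is built on chosen representatives; the strict margin rho^m absorbs the passage to an
    arbitrary one. *)
Lemma gvnorm_lt_coord n (X : 'rV[Rt]_n) r re x : gvnorm X <~ r ->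
  represents re r -> vrepresents x X ->
  \forall e \near 0^'+, forall i, `|x e 0 i| <= re e.
Proof.
move=> /gltP/[swap] rer /(_ _ _ (gvnorm_represents X) rer)[m Xr] /vrepresentsP xX.
have h i : \forall e \near 0^'+, `|x e 0 i - grepr (X 0 i) e| <= rho e ^+ m.
  by have /negligible_natP := represents_eq (xX i) (grepr_represents (X 0 i)); exact.
have {}h := filter_forall _ h.
near=> e => i; have hi : `|x e 0 i - grepr (X 0 i) e| <= rho e ^+ m by move: (i); near: e; exact: h.
have := enorm_coord (\row_i grepr (X 0 i) e) i; rewrite mxE.
have : enorm (\row_i grepr (X 0 i) e) + rho e ^+ m <= re e by near: e.
have := ler_normD (x e 0 i - grepr (X 0 i) e) (grepr (X 0 i) e).
by rewrite subrK; move: hi; lra.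
Unshelve. all: by end_near. Qed.

(** The exponent [m] depends only on [r] and [n], so it can be fixed before the vectors to be
    compared are known. *)
Lemma coord_gvnorm_lt n (r : Rt) : 0 <~ r ->
  exists m, forall k (X : 'rV[Rt]_n) x, (m <= k)%N -> vrepresents x X ->
  (\forall e \near 0^'+, forall i, `|x e 0 i| <= rho e ^+ k) -> gvnorm X <~ r.
Proof.
have rer := grepr_represents r.
move=> /(gltP represents0 rer)[m0 m0r].
exists m0.+1 => k X x mk /vrepresentsP xX xk; apply/(gltP (gvnorm_represents X) rer).
exists m0.+1; have h i : \forall e \near 0^'+, `|grepr (X 0 i) e - x e 0 i| <= rho e ^+ k.
  by have /negligible_natP := represents_eq (grepr_represents (X 0 i)) (xX i); exact.
have {}h := filter_forall _ h.
near=> e.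
(* Each chosen coordinate is at most 2 rho^(m0+1): one term bounds [x], the other the change of
   representative. The additional 1 is the strict margin. *)
have n1 : 0 < 2 * n%:R + 1 :> R by rewrite ltr_pwDr// mulr_ge0.
have /andP[r0 r1] : 0 < rho e < (2 * n%:R + 1)^-1.
  by near: e; apply: gauge_small; rewrite invr_gt0.
have rn : (2 * n%:R + 1) * rho e <= 1 by rewrite -ler_pdivlMl// mulr1 ltW.
have rl1 : rho e <= 1.
  by rewrite (le_trans _ rn)// ler_peMl ?(ltW r0)// lerDr mulr_ge0.
have s0 : 0 < rho e ^+ m0 by rewrite exprn_gt0.
have : 0 + rho e ^+ m0 <= grepr r e by near: e.
apply: le_trans; rewrite add0r.
apply: (@le_trans _ _ (\sum_(i < n) (2 * rho e ^+ m0.+1) + rho e ^+ m0.+1)).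
  rewrite lerD2r (le_trans (enorm_sum _))// ler_sum// => i _; rewrite mxE.
  have hi : `|grepr (X 0 i) e - x e 0 i| <= rho e ^+ k by move: (i); near: e; exact: h.
  have xi : `|x e 0 i| <= rho e ^+ k by move: (i); near: e; exact: xk.
  have rk : rho e ^+ k <= rho e ^+ m0.+1 by rewrite ler_wiXn2l ?(ltW r0).
  have := ler_normD (grepr (X 0 i) e - x e 0 i) (x e 0 i).
  by rewrite subrK; lra.
rewrite sumr_const card_ord -mulr_natl exprS.
by rewrite -[leRHS]mul1r (le_trans _ (ler_wpM2r (ltW s0) rn))//; lra.
Unshelve. all: by end_near. Qed.

Lemma sharp_interior_subset n (X : set 'rV[Rt]_n) : sharp_interior X `<=` X.
Proof.
move=> x [r r0 xX]; apply: xX; have [m] := @coord_gvnorm_lt n _ r0.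
apply; first exact: leqnn.
  rewrite subrr; exact: vrepresents0.
near=> e => i.
have /andP[e0 _] : 0 < rho e < 1 by clear i; near: e; exact: gauge_small.
by rewrite mxE normr0 exprn_ge0// ltW.
Unshelve. all: by end_near. Qed.

End VectorClasses.

(** * Families of differentiable real functions *)

Section RealFamilies.
Context {R : realType} (rho : asymptotic_gauge R).
Implicit Types (ae be : R -> R) (h : R -> R -> R).

(** One spare power of rho buys the factor 1/4, so that several error terms can be added and still
    stay below rho^m. *)
Lemma exprn_quarter (r : R) m n : 0 < r <= 4^-1 -> (m < n)%N ->
  r ^+ n <= 4^-1 * r ^+ m.
Proof.
move=> /andP[r0 r1] mn; rewrite (@le_trans _ _ (r ^+ m.+1))//.
  by rewrite ler_wiXn2l ?(ltW r0)//; lra.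
by rewrite exprS ler_wpM2r ?exprn_ge0 ?(ltW r0).
Qed.

Lemma is_derive_continuous (h : R -> R) (t l : R) :
  is_derive t 1 h l -> {for t, continuous h}.
Proof. by case=> hd _; exact/differentiable_continuous/derivable1_diffP. Qed.

(** The order of [x] and [y] is left open so that a step can go either way; the distance bound on
    [z] prepares a second application, to the derivative between [x] and [z]. *)
Lemma MVT_between (h dh : R -> R) (A B x y : R) :
  (forall t, A <= t <= B -> is_derive t 1 h (dh t)) ->
  A <= x <= B -> A <= y <= B ->
  exists2 z, A <= z <= B /\ `|z - x| <= `|y - x| & h y - h x = dh z * (y - x).
Proof.
move=> hd.
have key u v : u <= v -> A <= u -> v <= B ->
    exists2 z, u <= z <= v & h v - h u = dh z * (v - u).
  move=> uv Au vB; have [z|z|z zuv hz] := @MVT_segment R h dh u v uv.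
  - by rewrite in_itv/= => /andP[uz zv]; apply: hd; apply/andP; split; lra.
  - apply: continuous_in_subspaceT => t; rewrite inE/= in_itv/= => /andP[ut tv].
    by apply/is_derive_continuous/hd/andP; split; lra.
  - by exists z => //; move: zuv; rewrite in_itv.
move=> /andP[Ax xB] /andP[Ay yB]; have [xy|/ltW yx] := leP x y.
  have [z /andP[xz zy] ->] := key _ _ xy Ax yB; exists z => //.
  by rewrite !ger0_norm ?subr_ge0//; split; [apply/andP; split|]; lra.
have [z /andP[yz zx] hyx] := key _ _ yx Ay xB; exists z.
  by rewrite !ler0_norm ?subr_le0//; split; [apply/andP; split|]; lra.
by rewrite -opprB hyx; ring.
Qed.

(* A choice of counterexamples, one for each e, is itself a net. *)
Lemma near_all_between ae be (P : R -> R -> Prop) :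
  (\forall e \near 0^'+, ae e <= be e) ->
  (forall te : R -> R, (\forall e \near 0^'+, ae e <= te e <= be e) ->
    \forall e \near 0^'+, P e (te e)) ->
  \forall e \near 0^'+, forall t, ae e <= t <= be e -> P e t.
Proof.
move=> ab hP.
have /choice[te teP] e : exists t, ae e <= be e -> ae e <= t <= be e /\
    (P e t -> forall s, ae e <= s <= be e -> P e s).
  have [[s [sab nP]]|nex] := pselect (exists s, ae e <= s <= be e /\ ~ P e s).
    by exists s.
  exists (ae e) => abe; rewrite lexx abe; split=> // _ s sab.
  by apply: contrapT => nP; apply: nex; exists s.
have tab : \forall e \near 0^'+, ae e <= te e <= be e.
  by near=> e; apply: (teP e _).1; near: e.
have tP := hP te tab.
by near=> e; apply: (teP e _).2; near: e.
Unshelve. all: by end_near. Qed.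

Lemma near_EVT_max ae be h :
  (\forall e \near 0^'+, ae e <= be e) ->
  (\forall e \near 0^'+, forall t, ae e <= t <= be e -> {for t, continuous (h e)}) ->
  exists te, \forall e \near 0^'+, ae e <= te e <= be e /\
    forall t, ae e <= t <= be e -> h e t <= h e (te e).
Proof.
move=> ab hc.
have /choice[te teP] e : exists t, ae e <= be e ->
    (forall t, ae e <= t <= be e -> {for t, continuous (h e)}) ->
    ae e <= t <= be e /\ forall s, ae e <= s <= be e -> h e s <= h e t.
  have [abe|nab] := pselect (ae e <= be e); last by exists 0.
  have [hce|nc] := pselect (forall t, ae e <= t <= be e ->
    {for t, continuous (h e)}); last by exists 0.
  have [|c cab cmax] := @EVT_max R (h e) _ _ abe.
    by apply: continuous_in_subspaceT => t; rewrite inE/= in_itv/=; exact: hce.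
  exists c => _ _; split; first by move: cab; rewrite in_itv.
  by move=> s sab; apply: cmax; rewrite in_itv.
by exists te; apply: filterS2 ab hc => e; exact: teP.
Qed.

(** The maximizers of |h| form one of the admissible nets, so the exponent found along them serves
    for all [t]. *)
Lemma uniformly_moderate ae be h dh :
  (\forall e \near 0^'+, ae e <= be e) ->
  (\forall e \near 0^'+, forall t, ae e <= t <= be e ->
     is_derive t 1 (h e) (dh e t)) ->
  (forall te, (\forall e \near 0^'+, ae e <= te e <= be e) ->
     net_moderate rho (fun e => h e (te e))) ->
  exists n, \forall e \near 0^'+, forall t, ae e <= t <= be e ->
     `|h e t| * rho e ^+ n <= 1.
Proof.
move=> ab hd hm.
have [|te teP] := @near_EVT_max _ _ (fun e t => `|h e t|) ab.
  apply: filterS hd => e hde t tab; apply: continuous_comp; last exact: norm_continuous.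
  exact: is_derive_continuous (hde t tab).
have tab : \forall e \near 0^'+, ae e <= te e <= be e by apply: filterS teP => e [].
have /moderate_natP[n hn] := hm te tab; exists n; near=> e.
have /andP[r0 _] : 0 < rho e < 1 by near: e; exact: gauge_small.
have [_ tmax] : ae e <= te e <= be e /\
  forall t, ae e <= t <= be e -> `|h e t| <= `|h e (te e)| by near: e.
have hne : `|h e (te e)| * rho e ^+ n <= 1 by near: e.
move=> t tabe; apply: le_trans hne.
by rewrite ler_wpM2r ?exprn_ge0 ?(ltW r0)// tmax.
Unshelve. all: by end_near. Qed.

(** Interpolation between [h] and [h2]: over a step rho^P the difference quotient of [h] is still
    small, while the bound on [h2] lets [h1] vary by at most rho^(P-M). *)
Lemma negligible_derivative ae be h h1 h2 q :
  (\forall e \near 0^'+, ae e + rho e ^+ q <= be e) ->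
  (\forall e \near 0^'+, forall t, ae e <= t <= be e ->
     is_derive t 1 (h e) (h1 e t)) ->
  (\forall e \near 0^'+, forall t, ae e <= t <= be e ->
     is_derive t 1 (h1 e) (h2 e t)) ->
  (exists n, \forall e \near 0^'+, forall t, ae e <= t <= be e ->
     `|h2 e t| * rho e ^+ n <= 1) ->
  (forall n, \forall e \near 0^'+, forall t, ae e <= t <= be e ->
     `|h e t| <= rho e ^+ n) ->
  forall n, \forall e \near 0^'+, forall t, ae e <= t <= be e ->
     `|h1 e t| <= rho e ^+ n.
Proof.
move=> ab hd1 hd2 [M hM] hn n.
(* Beyond [q] the step fits into the interval; beyond n + M the variation of [h1] over a step stays
   below rho^n / 4. Dividing by the step costs rho^P, so [h] is controlled to order P + n + 1. *)
pose P := (q + n + M + 2)%N.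
have hP := hn (P + (n + 1))%N.
near=> e.
have /andP[r0 r1] : 0 < rho e < 4^-1.
  by near: e; apply: gauge_small; rewrite invr_gt0.
have abe : ae e + rho e ^+ q <= be e by near: e.
have hd1e : forall t, ae e <= t <= be e -> is_derive t 1 (h e) (h1 e t).
  by near: e.
have hd2e : forall t, ae e <= t <= be e -> is_derive t 1 (h1 e) (h2 e t).
  by near: e.
have hMe : forall t, ae e <= t <= be e -> `|h2 e t| * rho e ^+ M <= 1.
  by near: e.
have hPe : forall t, ae e <= t <= be e -> `|h e t| <= rho e ^+ (P + (n + 1)).
  by near: e.
move=> t tab.
have Pq : rho e ^+ P <= 4^-1 * rho e ^+ q.
  by rewrite exprn_quarter ?r0 ?(ltW r1)// /P; lia.
have Pn : rho e ^+ P <= 4^-1 * rho e ^+ (n + M).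
  by rewrite exprn_quarter ?r0 ?(ltW r1)// /P; lia.
have q0 : 0 < rho e ^+ q by rewrite exprn_gt0.
have n0 : 0 < rho e ^+ n by rewrite exprn_gt0.
have P0 : 0 < rho e ^+ P by rewrite exprn_gt0.
(* The interval is at least four steps long, so one of the two directions stays inside. *)
have [y yab yt] : exists2 y, ae e <= y <= be e & `|y - t| = rho e ^+ P.
  have /andP[at_ tb] := tab; have [tP|tP] := leP (t + rho e ^+ P) (be e).
    exists (t + rho e ^+ P); first by apply/andP; split; lra.
    by rewrite addrAC subrr add0r gtr0_norm.
  exists (t - rho e ^+ P); first by apply/andP; split; lra.
  by rewrite addrAC subrr add0r normrN gtr0_norm.
have [z [zab zt] hz] := MVT_between hd1e tab yab.
have [w [wab _] hw] := MVT_between hd2e tab zab.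
have z1 : `|h1 e z| <= 2 * rho e ^+ (n + 1).
  rewrite -(ler_pM2r P0) -yt -normrM -hz yt -mulrA -exprD addnC.
  by rewrite (le_trans (ler_normB _ _))// mulr_natl mulr2n lerD// hPe.
have z2 : `|h1 e z - h1 e t| <= 4^-1 * rho e ^+ n.
  rewrite hw normrM; rewrite yt in zt.
  apply: (le_trans (ler_wpM2l (normr_ge0 _) (le_trans zt Pn))).
  have := ler_wpM2r (ltW n0) (hMe w wab); rewrite exprD; lra.
have rn : rho e ^+ (n + 1) <= 4^-1 * rho e ^+ n.
  by rewrite addn1 exprS ler_wpM2r ?exprn_ge0 ?(ltW r0) ?(ltW r1).
have -> : h1 e t = h1 e z - (h1 e z - h1 e t) by ring.
by rewrite (le_trans (ler_normB _ _))//; lra.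
Unshelve. all: by end_near. Qed.

End RealFamilies.

(** The symmetric difference cancels the first-order term, and the constant [k] is kept exactly: a
    lower bound on the difference thus becomes a lower bound on [k]. *)
Lemma second_difference_le (R : realType) (h0 h1 h2 : R -> R) (c d k : R) : 0 <= d ->
  (forall t : R, `|t - c| <= d -> is_derive t 1 h0 (h1 t)) ->
  (forall t : R, `|t - c| <= d -> is_derive t 1 h1 (h2 t)) ->
  (forall t : R, `|t - c| <= d -> h2 t <= k) ->
  h0 (c + d) + h0 (c - d) - 2 * h0 c <= k * d ^+ 2.
Proof.
move=> d0 hd0 hd1 h2k.
(* The second difference minus its majorant is nonincreasing on [0, d]. *)
pose w (t : R) := h0 (c + t) + h0 (c - t) - k * t ^+ 2.
pose dw (t : R) := h1 (c + t) - h1 (c - t) - k * (2 * t).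
have wd t : 0 <= t <= d -> is_derive t 1 w (dw t).
  move=> /andP[t0 td].
  have D1 : is_derive t 1 (h0 \o (fun t => c + t)) (h1 (c + t) * (0 + 1)).
    apply: is_derive1_comp; apply: hd0.
    by rewrite addrAC subrr add0r ger0_norm.
  have D2 : is_derive t 1 (h0 \o (fun t => c - t)) (h1 (c - t) * (0 - 1)).
    apply: is_derive1_comp; apply: hd0.
    by rewrite addrAC subrr add0r normrN ger0_norm.
  have D3 : is_derive t 1 (fun t : R => k * t ^+ 2) (k * (2 * t)).
    by apply: is_derive_eq; rewrite /GRing.scale /=; ring.
  have -> : w = (h0 \o (fun t => c + t)) + (h0 \o (fun t => c - t)) - (fun t : R => k * t ^+ 2).
    by apply/funext.
  by apply: is_derive_eq; rewrite /dw; ring.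
have zI : (0 : R) <= 0 <= d by apply/andP; split.
have dI : 0 <= d <= d by apply/andP; split.
have [z [/andP[z0 zd] _] hz] := MVT_between wd zI dI.
have dz t : `|t| <= z -> `|c + t - c| <= d.
  by move=> tz; rewrite addrAC subrr add0r (le_trans tz).
(* The mean value theorem across [c - z, c + z] gives h1 (c + z) - h1 (c - z) = 2 z h2 (c + y) <= 2
   k z. *)
have dwz : dw z <= 0.
  have zIm : -z <= - z <= z by apply/andP; split; lra.
  have zIp : -z <= z <= z by apply/andP; split; lra.
  have sd t : -z <= t <= z -> is_derive t 1 (h1 \o (fun t => c + t)) (h2 (c + t) * (0 + 1)).
    by rewrite -ler_norml => /dz tz; apply: is_derive1_comp; apply: hd1.
  have [y [yz _] hy] := MVT_between sd zIm zIp.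
  move: hy; rewrite /dw /= => ->; have := h2k _ (dz y _); rewrite ler_norml => /(_ yz).
  by nra.
have : w d - w 0 <= 0 by rewrite hz subr0; nra.
by rewrite /w subr0 addr0 expr0n /= mulr0; lra.
Qed.

(** * First- and second-order conditions at an approximate minimum of a net *)

Section Fermat.
Context {R : realType} (rho : asymptotic_gauge R).
Variables (h0 h1 h2 : R -> R -> R) (x : R -> R) (N0 : nat).
Hypothesis x_small : \forall e \near 0^'+, `|x e| <= 2^-1.
Hypothesis h0_min : forall (s : R) N, (s = 1 \/ s = -1) -> (N0 <= N)%N ->
  forall n, \forall e \near 0^'+,
    h0 e (x e) <= h0 e (x e + s * rho e ^+ N) + rho e ^+ n.
Hypothesis hd0 : \forall e \near 0^'+, forall t : R, -1 <= t <= 1 ->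
  is_derive t 1 (h0 e) (h1 e t).
Hypothesis hd1 : \forall e \near 0^'+, forall t : R, -1 <= t <= 1 ->
  is_derive t 1 (h1 e) (h2 e t).

Lemma fermat_net :
  (exists n, \forall e \near 0^'+, forall t : R, -1 <= t <= 1 ->
     `|h2 e t| * rho e ^+ n <= 1) ->
  net_negligible rho (fun e => h1 e (x e)).
Proof.
move=> [M hM]; apply/negligible_natP => n.
(* The step rho^N must be admissible, and so short that [h1] varies by at most rho^n / 4 over it.
   The slack of order N + n + 1 leaves rho^(n+1) after division by the step. *)
pose N := (N0 + n + M + 2)%N.
have N0N : (N0 <= N)%N by rewrite /N; lia.
have hp := h0_min (or_introl erefl) N0N (N + (n + 1))%N.
have hm := h0_min (or_intror erefl) N0N (N + (n + 1))%N.
near=> e.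
have /andP[r0 r1] : 0 < rho e < 4^-1.
  by near: e; apply: gauge_small; rewrite invr_gt0.
have hd0e : forall t : R, -1 <= t <= 1 -> is_derive t 1 (h0 e) (h1 e t) by near: e.
have hd1e : forall t : R, -1 <= t <= 1 -> is_derive t 1 (h1 e) (h2 e t) by near: e.
have hMe : forall t : R, -1 <= t <= 1 -> `|h2 e t| * rho e ^+ M <= 1 by near: e.
have xe : `|x e| <= 2^-1 by near: e.
have hpe : h0 e (x e) <= h0 e (x e + 1 * rho e ^+ N) + rho e ^+ (N + (n + 1)).
  by near: e.
have hme : h0 e (x e) <= h0 e (x e + -1 * rho e ^+ N) + rho e ^+ (N + (n + 1)).
  by near: e.
have d0 : 0 < rho e ^+ N by rewrite exprn_gt0.
have n0 : 0 < rho e ^+ n by rewrite exprn_gt0.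
have d1 : rho e ^+ N <= 4^-1.
  by have := @exprn_quarter _ (rho e) 0 N; rewrite expr0 mulr1; apply;
    rewrite ?r0 ?(ltW r1)// /N; lia.
have dn : rho e ^+ N <= 4^-1 * rho e ^+ (n + M).
  by rewrite exprn_quarter ?r0 ?(ltW r1)// /N; lia.
have rn : rho e ^+ (n + 1) <= 4^-1 * rho e ^+ n.
  by rewrite addn1 exprS ler_wpM2r ?exprn_ge0 ?(ltW r0) ?(ltW r1).
(* The sign s = 1 bounds [h1] from below, s = -1 from above. *)
have key s : `|s| = 1 ->
    h0 e (x e) <= h0 e (x e + s * rho e ^+ N) + rho e ^+ (N + (n + 1)) ->
    - rho e ^+ n <= s * h1 e (x e).
  move=> s1 hs.
  have xI : -1 <= x e <= 1 by move: xe; rewrite ler_norml => /andP[? ?]; apply/andP; split; lra.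
  have ys : `|s * rho e ^+ N| = rho e ^+ N by rewrite normrM s1 mul1r gtr0_norm.
  have yI : -1 <= x e + s * rho e ^+ N <= 1.
    rewrite -ler_norml (le_trans (ler_normD _ _))// ys; lra.
  have [z [zI zx] hz] := MVT_between hd0e xI yI.
  have [w [wI _] hw] := MVT_between hd1e xI zI.
  move: hz zx; rewrite addrAC subrr add0r ys => hz zx.
  have z1 : - rho e ^+ (n + 1) <= s * h1 e z.
    by rewrite -(ler_pM2r d0) mulNr -exprD [(n + 1 + _)%N]addnC; lra.
  have z2 : `|h1 e z - h1 e (x e)| <= 4^-1 * rho e ^+ n.
    rewrite hw normrM.
    apply: (le_trans (ler_wpM2l (normr_ge0 _) (le_trans zx dn))).
    by have := ler_wpM2r (ltW n0) (hMe w wI); rewrite exprD; lra.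
  have : `|s * (h1 e z - h1 e (x e))| <= 4^-1 * rho e ^+ n by rewrite normrM s1 mul1r.
  by rewrite ler_norml => /andP[? ?]; lra.
have := key 1 (normr1 _) hpe; have := key (-1) (normrN1 _) hme.
by rewrite ler_norml => ? ?; apply/andP; split; lra.
Unshelve. all: by end_near. Qed.

(** Adding the inequalities at both test points removes [h1] and bounds the second difference below
    by minus twice the slack. *)
Lemma fermat_net2 h3 :
  (\forall e \near 0^'+, forall t : R, -1 <= t <= 1 ->
     is_derive t 1 (h2 e) (h3 e t)) ->
  (exists n, \forall e \near 0^'+, forall t : R, -1 <= t <= 1 ->
     `|h3 e t| * rho e ^+ n <= 1) ->
  forall n, \forall e \near 0^'+, - rho e ^+ n <= h2 e (x e).
Proof.
move=> hd2 [M hM] n.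
pose N := (N0 + n + M + 3)%N.
have N0N : (N0 <= N)%N by rewrite /N; lia.
(* The second difference is divided by the square of the step, hence N + N. *)
have hp := h0_min (or_introl erefl) N0N (N + N + (n + 1))%N.
have hm := h0_min (or_intror erefl) N0N (N + N + (n + 1))%N.
near=> e.
have /andP[r0 r1] : 0 < rho e < 4^-1.
  by near: e; apply: gauge_small; rewrite invr_gt0.
have hd0e : forall t : R, -1 <= t <= 1 -> is_derive t 1 (h0 e) (h1 e t) by near: e.
have hd1e : forall t : R, -1 <= t <= 1 -> is_derive t 1 (h1 e) (h2 e t) by near: e.
have hd2e : forall t : R, -1 <= t <= 1 -> is_derive t 1 (h2 e) (h3 e t) by near: e.
have hMe : forall t : R, -1 <= t <= 1 -> `|h3 e t| * rho e ^+ M <= 1 by near: e.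
have xe : `|x e| <= 2^-1 by near: e.
have hpe : h0 e (x e) <= h0 e (x e + 1 * rho e ^+ N) + rho e ^+ (N + N + (n + 1)).
  by near: e.
have hme : h0 e (x e) <= h0 e (x e + -1 * rho e ^+ N) + rho e ^+ (N + N + (n + 1)).
  by near: e.
have n0 : 0 < rho e ^+ n by rewrite exprn_gt0.
have d0 : 0 < rho e ^+ N by rewrite exprn_gt0.
have d1 : rho e ^+ N <= 4^-1.
  by have := @exprn_quarter _ (rho e) 0 N; rewrite expr0 mulr1; apply;
    rewrite ?r0 ?(ltW r1)// /N; lia.
have dn : rho e ^+ N <= 4^-1 * rho e ^+ (n + M).
  by rewrite exprn_quarter ?r0 ?(ltW r1)// /N; lia.
have rn : rho e ^+ (n + 1) <= 4^-1 * rho e ^+ n.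
  by rewrite addn1 exprS ler_wpM2r ?exprn_ge0 ?(ltW r0) ?(ltW r1).
rewrite exprD exprD in hpe hme.
move: (rho e ^+ N) (rho e ^+ (n + 1)) d0 d1 dn rn hpe hme => d r' d0 d1 dn rn hpe hme.
have xI : -1 <= x e <= 1 by move: xe; rewrite ler_norml => /andP[? ?]; apply/andP; split; lra.
have xdI t : `|t| <= d -> -1 <= x e + t <= 1.
  by move=> td; rewrite -ler_norml (le_trans (ler_normD _ _))//; lra.
(* Within one step of [x], the bound on [h3] lets [h2] grow by at most rho^n / 4, so [k] dominates
   it there. *)
pose k := h2 e (x e) + 4^-1 * rho e ^+ n.
have h2k z : `|z - x e| <= d -> h2 e z <= k.
  move=> zx; have zI : -1 <= z <= 1 by rewrite -(subrK (x e) z) addrC xdI.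
  have [w [wI _] hw] := MVT_between hd2e xI zI.
  have : `|h2 e z - h2 e (x e)| <= 4^-1 * rho e ^+ n.
    rewrite hw normrM.
    apply: (le_trans (ler_wpM2l (normr_ge0 _) (le_trans zx dn))).
    by have := ler_wpM2r (ltW n0) (hMe w wI); rewrite exprD; lra.
  by rewrite ler_norml /k => /andP[? ?]; lra.
have hx t : `|t - x e| <= d -> -1 <= t <= 1.
  by move=> tx; rewrite -(subrK (x e) t) addrC xdI.
have := @second_difference_le _ (h0 e) (h1 e) (h2 e) (x e) d k (ltW d0)
  (fun t tx => hd0e t (hx t tx)) (fun t tx => hd1e t (hx t tx)) h2k.
rewrite mul1r mulN1r in hpe hme => h.
have : - 2 * r' <= k.
  by rewrite -(ler_pM2r (exprn_gt0 2 d0)); rewrite expr2 in h *; lra.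
by rewrite /k; lra.
Unshelve. all: by end_near. Qed.

End Fermat.

(** In the only coordinate, the directional quotient at [const_mx t] is the ordinary quotient in
    [t]; iterated partials become a chain of real derivatives, open to the mean value theorem. *)
Lemma is_derive_partials (R : realType) k (D : set 'rV[R]_1) (f : 'rV[R]_1 -> 'rV[R]_k)
    j i (t : R) : smooth_on D f -> D (const_mx t) ->
  is_derive t 1 (fun t : R => partials (nseq j 0) f (const_mx t) 0 i)
    (partials (nseq j.+1 0) f (const_mx t) 0 i).
Proof.
move=> fD Dt; set G := partials (nseq j 0) f.
have /(_ (delta_mx 0 0))Gd : forall v, derivable G (const_mx t) v.
  by move=> v; apply: diff_derivable; exact: fD.
have shiftE (h : R) : h *: delta_mx 0 0 + const_mx t = const_mx (h + t) :> 'rV[R]_1.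
  by apply/rowP => l; rewrite !mxE !ord1 eqxx mulr1.
have h : (h^-1 *: (((fun s : R => G (const_mx s) 0 i) \o shift t) (h *: 1)
    - G (const_mx t) 0 i)) @[h --> 0^'] --> ('D_(delta_mx 0 0) G (const_mx t)) 0 i.
  have -> : (fun h : R => h^-1 *: (((fun s : R => G (const_mx s) 0 i) \o shift t) (h *: 1)
      - G (const_mx t) 0 i)) = (fun M : 'rV[R]_k => M 0 i) \o
      (fun h => h^-1 *: ((G \o shift (const_mx t)) (h *: delta_mx 0 0) - G (const_mx t))).
    by apply/funext => h; rewrite /= shiftE !mxE [h *: 1]mulr1.
  by apply: continuous_cvg; [exact: coord_continuous|exact: Gd].
by split; [apply/cvg_ex; eexists; exact: h|exact: (cvg_lim _ h)].
Qed.

(** * Derivatives of generalized smooth functions of one variable *)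

Section GsfNets.
Context {R : realType} {rho : asymptotic_gauge R}.
Local Notation Rt := (gnum rho).

Variables (k : nat) (Om : R -> set 'rV[R]_1) (fe : R -> 'rV[R]_1 -> 'rV[R]_k).
Variables (X : set 'rV[Rt]_1) (f : 'rV[Rt]_1 -> 'rV[Rt]_k) (a b : Rt).
Variables (ae be : R -> R).
Hypotheses (fef : gsf_net Om fe X f) (abX : gline (gitv a b) `<=` X).
Hypotheses (aea : represents ae a) (beb : represents be b).
Hypothesis ab : \forall e \near 0^'+, ae e <= be e.

(** The hypotheses on a generalized function are pointwise; this makes them available along every
    real net between the endpoint representatives. *)
Let between_gitv te : (\forall e \near 0^'+, ae e <= te e <= be e) ->
  represents te (gclass te : Rt) /\ X (const_mx (gclass te)).
Proof.
move=> /(gitv_represents aea beb)[tet tab]; split=> //.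
by apply: abX; rewrite /gline /= mxE.
Qed.

(** Membership in [Om e] is known along single nets, each with its own range of [e];
    [near_all_between] makes that range uniform in [t]. *)
Lemma gsf_net_is_derive : \forall e \near 0^'+, forall t, ae e <= t <= be e ->
  forall j i, is_derive t 1 (fun t : R => partials (nseq j 0) (fe e) (const_mx t) 0 i)
    (partials (nseq j.+1 0) (fe e) (const_mx t) 0 i).
Proof.
have [smooth inOm _ _] := fef.
have tOm : \forall e \near 0^'+, forall t, ae e <= t <= be e -> Om e (const_mx t).
  apply: near_all_between => // te /between_gitv[tet /inOm]; apply.
  exact: vrepresents_const.
near=> e => t tab j i; apply: (@is_derive_partials _ _ (Om e)).
  by apply: (smooth e _).2; clear t tab; near: e; exact: near_I0.
by move: t tab; near: e.
Unshelve. all: by end_near. Qed.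

Lemma gsf_net_moderate j : exists n, \forall e \near 0^'+, forall i t,
  ae e <= t <= be e -> `|partials (nseq j 0) (fe e) (const_mx t) 0 i| * rho e ^+ n <= 1.
Proof.
have [_ _ _ fem] := fef.
have /choice[n hn] i : exists n, \forall e \near 0^'+, forall t,
    ae e <= t <= be e -> `|partials (nseq j 0) (fe e) (const_mx t) 0 i| * rho e ^+ n <= 1.
  apply: (uniformly_moderate (dh := fun e t => partials (nseq j.+1 0) (fe e) (const_mx t) 0 i) ab).
    by apply: filterS gsf_net_is_derive => e h t tab; exact: h.
  move=> te /between_gitv[tet tX].
  by have /vmoderateP := fem (nseq j 0) _ _ tX (vrepresents_const tet); exact.
have {}hn := filter_forall _ hn.
exists (\max_i n i); near=> e => i t tab.
have /andP[r0 r1] : 0 < rho e < 1 by near: e; exact: gauge_small.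
apply: (@le_trans _ _ (`|partials (nseq j 0) (fe e) (const_mx t) 0 i| * rho e ^+ n i)).
  by rewrite ler_wpM2l// ler_wiXn2l ?(ltW r0) ?(ltW r1)// leq_bigmax.
by move: i t tab; near: e; exact: hn.
Unshelve. all: by end_near. Qed.

End GsfNets.

(** * Comparison of two chains of derivatives *)

Section Families.
Context {R : realType} (rho : asymptotic_gauge R).
Variables (ae be : R -> R) (q : nat).
Hypothesis ab : \forall e \near 0^'+, ae e + rho e ^+ q <= be e.
Variables c c' : nat -> R -> R -> R.
Hypothesis cd : forall j, \forall e \near 0^'+, forall t, ae e <= t <= be e ->
  is_derive t 1 (c j e) (c j.+1 e t).
Hypothesis cd' : forall j, \forall e \near 0^'+, forall t, ae e <= t <= be e ->
  is_derive t 1 (c' j e) (c' j.+1 e t).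
Hypothesis cm : forall j, exists n, \forall e \near 0^'+, forall t,
  ae e <= t <= be e -> `|c j e t| * rho e ^+ n <= 1.
Hypothesis cm' : forall j, exists n, \forall e \near 0^'+, forall t,
  ae e <= t <= be e -> `|c' j e t| * rho e ^+ n <= 1.

(** Each step of the induction on the order passes negligibility on by [negligible_derivative], at
    the price of the moderate bounds two orders higher. *)
Lemma derivatives_negligible :
  (forall n, \forall e \near 0^'+, forall t, ae e <= t <= be e ->
    `|c 0 e t - c' 0 e t| <= rho e ^+ n) ->
  forall j n, \forall e \near 0^'+, forall t, ae e <= t <= be e ->
    `|c j e t - c' j e t| <= rho e ^+ n.
Proof.
move=> c0; pose h (j : nat) e t := c j e t - c' j e t.
have hd l : \forall e \near 0^'+, forall t, ae e <= t <= be e ->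
    is_derive t 1 (h l e) (h l.+1 e t).
  apply: filterS2 (cd l) (cd' l) => e cde cde' t tab.
  by apply: is_deriveB; [exact: cde|exact: cde'].
elim=> [//|l IH]; apply: (negligible_derivative ab (hd l) (hd l.+1)) => //.
have [n1 h1] := cm l.+2; have [n2 h2] := cm' l.+2.
exists (maxn n1 n2).+1; near=> e.
have /andP[r0 r1] : 0 < rho e < 4^-1.
  by near: e; apply: gauge_small; rewrite invr_gt0.
have h1e : forall t, ae e <= t <= be e -> `|c l.+2 e t| * rho e ^+ n1 <= 1.
  by near: e.
have h2e : forall t, ae e <= t <= be e -> `|c' l.+2 e t| * rho e ^+ n2 <= 1.
  by near: e.
move=> t tab; have m1 := h1e t tab; have m2 := h2e t tab.
have q1 : rho e ^+ (maxn n1 n2).+1 <= 4^-1 * rho e ^+ n1.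
  by rewrite exprn_quarter ?r0 ?(ltW r1)// ltnS leq_maxl.
have q2 : rho e ^+ (maxn n1 n2).+1 <= 4^-1 * rho e ^+ n2.
  by rewrite exprn_quarter ?r0 ?(ltW r1)// ltnS leq_maxr.
have s0 : 0 < rho e ^+ (maxn n1 n2).+1 by rewrite exprn_gt0.
rewrite (le_trans (ler_wpM2r (ltW s0) (ler_normB _ _)))// mulrDl.
have := ler_wpM2l (normr_ge0 (c l.+2 e t)) q1.
have := ler_wpM2l (normr_ge0 (c' l.+2 e t)) q2.
by move: m1 m2; lra.
Unshelve. all: by end_near. Qed.

Lemma derivatives_negligible_at xe xe' :
  (forall n, \forall e \near 0^'+, forall t, ae e <= t <= be e ->
    `|c 0 e t - c' 0 e t| <= rho e ^+ n) ->
  (forall e, ae e <= xe e <= be e) -> (forall e, ae e <= xe' e <= be e) ->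
  net_negligible rho (xe - xe') ->
  forall j, net_negligible rho (fun e => c j e (xe e) - c' j e (xe' e)).
Proof.
move=> c0 xab xab' /negligible_natP xx j; apply/negligible_natP => n.
have hjn := derivatives_negligible c0 j n.+1.
have [m cmj] := cm' j.+1.
have {}xx := xx (n + m).+1.
near=> e.
have /andP[r0 r1] : 0 < rho e < 4^-1.
  by near: e; apply: gauge_small; rewrite invr_gt0.
have hx : `|c j e (xe e) - c' j e (xe e)| <= rho e ^+ n.+1.
  have hje : forall t, ae e <= t <= be e -> `|c j e t - c' j e t| <= rho e ^+ n.+1.
    by near: e.
  exact: hje.
have xxe : `|xe e - xe' e| <= rho e ^+ (n + m).+1 by near: e.
have cde : forall t, ae e <= t <= be e -> is_derive t 1 (c' j e) (c' j.+1 e t).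
  by near: e; exact: cd'.
have cme : forall t, ae e <= t <= be e -> `|c' j.+1 e t| * rho e ^+ m <= 1.
  by near: e.
have [z [zab _] hz] := MVT_between cde (xab' e) (xab e).
have cz := cme z zab.
have s0 : 0 < rho e ^+ n by rewrite exprn_gt0.
have qn : rho e ^+ n.+1 <= 4^-1 * rho e ^+ n by rewrite exprn_quarter ?r0 ?(ltW r1).
have qnm : rho e ^+ (n + m).+1 <= 4^-1 * rho e ^+ (n + m).
  by rewrite exprn_quarter ?r0 ?(ltW r1).
(* First the family changes at a fixed point, then the point within a fixed family. *)
have -> : c j e (xe e) - c' j e (xe' e) =
    (c j e (xe e) - c' j e (xe e)) + (c' j e (xe e) - c' j e (xe' e)) by ring.
rewrite (le_trans (ler_normD _ _))// hz normrM.
have := ler_wpM2l (normr_ge0 (c' j.+1 e z)) (le_trans xxe qnm).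
have := ler_wpM2r (ltW s0) cz; rewrite exprD.
by lra.
Unshelve. all: by end_near. Qed.

End Families.

(** * Independence of the defining net, and density of interior points *)

Section GsfDerivatives.
Context {R : realType} {rho : asymptotic_gauge R}.
Local Notation Rt := (gnum rho).
Variables (a b : Rt) (k : nat) (f : 'rV[Rt]_1 -> 'rV[Rt]_k).
Hypothesis ab : a <~ b.
Local Notation ab_line := (gline (gitv a b)).

Lemma partials_unique Om fe Om' fe' j x xe xe' :
  gsf_net Om fe ab_line f -> gsf_net Om' fe' ab_line f ->
  gitv a b x -> represents xe x -> represents xe' x ->
  forall i, net_negligible rho (fun e => partials (nseq j 0) (fe e) (const_mx (xe e)) 0 i -
    partials (nseq j 0) (fe' e) (const_mx (xe' e)) 0 i).
Proof.
move=> fef fef' xab xex xex' i.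
have [ae [be [aea beb xabe xabe']]] := gitv_between2 xab xex xab xex'.
have abe : \forall e \near 0^'+, ae e <= be e.
  by near=> e; have /andP[ax xb] := xabe e; exact: le_trans xb.
have [q abq] := (gltP aea beb).1 ab.
have fam Om0 fe0 (f0 : gsf_net Om0 fe0 ab_line f) :
    (forall j, \forall e \near 0^'+, forall t, ae e <= t <= be e ->
      is_derive t 1 (fun t : R => partials (nseq j 0) (fe0 e) (const_mx t) 0 i)
        (partials (nseq j.+1 0) (fe0 e) (const_mx t) 0 i)) /\
    (forall j, exists n, \forall e \near 0^'+, forall t, ae e <= t <= be e ->
      `|partials (nseq j 0) (fe0 e) (const_mx t) 0 i| * rho e ^+ n <= 1).
  split=> l.
    apply: filterS (gsf_net_is_derive f0 (@subset_refl _ _) aea beb abe) => e h t tab.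
    exact: (h t tab l i).
  have [n hn] := gsf_net_moderate f0 (@subset_refl _ _) aea beb abe l.
  by exists n; apply: filterS hn => e h t tab; exact: (h i t tab).
have [cd cm] := fam _ _ fef; have [cd' cm'] := fam _ _ fef'.
apply: (derivatives_negligible_at abq cd cd' cm cm' _ xabe xabe' (represents_eq xex xex') j) => n.
(* Both nets represent [f] at every generalized point, so they differ negligibly along each net; the
   difference is thus negligible uniformly in [t]. *)
apply: near_all_between => // te /(gitv_represents aea beb)[tet tab].
have [_ _ fv _] := fef; have [_ _ fv' _] := fef'.
have tX : ab_line (const_mx (gclass te)) by rewrite /gline /= mxE.
have /vrepresentsP/(_ i) v := fv _ _ tX (vrepresents_const tet).
have /vrepresentsP/(_ i) v' := fv' _ _ tX (vrepresents_const tet).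
by have /negligible_natP := represents_eq v v'; exact.
Unshelve. all: by end_near. Qed.

Lemma sharp_interior_dense x P ae be xe : gitv a b x -> represents ae a ->
  represents be b -> represents xe x ->
  (forall e, ae e <= be e -> ae e <= xe e <= be e) ->
  exists y ye, [/\ represents ye y, sharp_interior ab_line (const_mx y),
    gitv a b y,
    \forall e \near 0^'+, ae e <= ye e <= be e
    & \forall e \near 0^'+, `|ye e - xe e| <= rho e ^+ P].
Proof.
move=> xab aea beb xex xeab.
have [q abq] := (gltP aea beb).1 ab.
(* [P] gives the closeness; q + 1 makes the step at most a quarter of the length. Stepping away from
   the nearer end leaves room rho^K on both sides, the radius of a ball inside [a, b]. *)
pose K := maxn P q.+1.
pose ye e := if xe e <= 2^-1 * (ae e + be e) then xe e + rho e ^+ K else xe e - rho e ^+ K.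
have yP : \forall e \near 0^'+, ae e + rho e ^+ K <= ye e <= be e - rho e ^+ K /\
    `|ye e - xe e| <= rho e ^+ P.
  near=> e.
  have /andP[r0 r1] : 0 < rho e < 4^-1.
    by near: e; apply: gauge_small; rewrite invr_gt0.
  have abe : ae e + rho e ^+ q <= be e by near: e.
  have q0 : 0 < rho e ^+ q by rewrite exprn_gt0.
  have K0 : 0 < rho e ^+ K by rewrite exprn_gt0.
  have Kq : rho e ^+ K <= 4^-1 * rho e ^+ q.
    by rewrite exprn_quarter ?r0 ?(ltW r1)// leq_maxr.
  have /andP[ax xb] : ae e <= xe e <= be e by apply: xeab; lra.
  have yx : `|ye e - xe e| = rho e ^+ K.
    rewrite /ye; case: ifP => _; rewrite addrAC subrr add0r ?normrN gtr0_norm//.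
  split; last by rewrite yx ler_wiXn2l ?(ltW r0)// ?leq_maxl//; lra.
  by rewrite /ye; case: (leP (xe e)) => h; apply/andP; split; lra.
have yab : \forall e \near 0^'+, ae e <= ye e <= be e.
  near=> e; have [/andP[h1 h2] _] : ae e + rho e ^+ K <= ye e <= be e - rho e ^+ K /\
    `|ye e - xe e| <= rho e ^+ P by near: e.
  have /andP[r0 r1] : 0 < rho e < 1 by near: e; exact: gauge_small.
  have K0 : 0 < rho e ^+ K by rewrite exprn_gt0.
  by apply/andP; split; lra.
have [yey ygab] := gitv_represents aea beb yab.
exists (gclass ye), ye; split=> //; last by apply: filterS yP => e [].
have rK := gaugeX_represents (rho := rho) K.
exists (gclass (fun e => rho e ^+ K)); first exact: gaugeX_gt0.
move=> z zy; have zz := grepr_represents (z 0 0).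
have zyr : vrepresents (fun e => const_mx (grepr (z 0 0) e - ye e)) (z - const_mx (gclass ye)).
  apply/vrepresentsP => i; rewrite !mxE ord1; under eq_fun do rewrite mxE.
  exact: represents_sub.
have {}zy := gvnorm_lt_coord zy rK zyr.
have zab : \forall e \near 0^'+, ae e <= grepr (z 0 0) e <= be e.
  near=> e; have [/andP[h1 h2] _] : ae e + rho e ^+ K <= ye e <= be e - rho e ^+ K /\
    `|ye e - xe e| <= rho e ^+ P by near: e.
  have zye : forall i : 'I_1, `|(const_mx (grepr (z 0 0) e - ye e) : 'rV_1) 0 i| <= rho e ^+ K.
    by near: e.
  have := zye 0.
  rewrite mxE ler_norml => /andP[h3 h4].
  by apply/andP; split; lra.
rewrite /gline /=; split.
  by apply: (gle_near aea zz); apply: filterS zab => e /andP[].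
by apply: (gle_near zz beb); apply: filterS zab => e /andP[].
Unshelve. all: by end_near. Qed.

End GsfDerivatives.

(** * Derivatives at all points of [a, b] *)

Section DerivativeOfGsf.
Context {R : realType} {rho : asymptotic_gauge R}.
Local Notation Rt := (gnum rho).
Variables (a b : Rt) (k : nat) (f : Rt -> 'rV[Rt]_k).
Hypothesis ab : a <~ b.
Local Notation ab_line := (gline (gitv a b)).
Variables (Om : R -> set 'rV[R]_1) (fe : R -> 'rV[R]_1 -> 'rV[R]_k).
Hypothesis fef : gsf_net Om fe ab_line (on_gline f).

(** A derivative value may come from any defining net; it is transferred here to the net [fe] fixed
    for the section. *)
Lemma net_partial_unique j x xe L : gitv a b x -> represents xe x ->
  net_partial ab_line (nseq j 0) (on_gline f) (const_mx x) L ->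
  vrepresents (fun e => partials (nseq j 0) (fe e) (const_mx (xe e))) L.
Proof.
move=> xab xex [Om' [fe' [ve [fef' /vrepresentsP vex /vrepresentsP L']]]].
apply/vrepresentsP => i; have {}vex := vex 0; rewrite mxE in vex.
apply: represents_negligible (L' i) _.
have /= := partials_unique ab j fef' fef xab vex xex i.
apply: negligible_le; near=> e.
rewrite !fctE (_ : const_mx (ve e 0 0) = ve e)//.
by apply/rowP => l; rewrite mxE ord1.
Unshelve. all: by end_near. Qed.

Lemma gsf_net_partial j x xe : gitv a b x -> represents xe x ->
  exists L, vrepresents (fun e => partials (nseq j 0) (fe e) (const_mx (xe e))) L
    /\ net_partial ab_line (nseq j 0) (on_gline f) (const_mx x) L.
Proof.
move=> xab xex; have [_ _ _ fem] := fef.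
have xX : ab_line (const_mx x) by rewrite /gline /= mxE.
have vm := fem (nseq j 0) _ _ xX (vrepresents_const xex).
exists (gvec (fun e => partials (nseq j 0) (fe e) (const_mx (xe e)))); split=> //.
by exists Om, fe, (fun e => const_mx (xe e)); split=> //; exact: vrepresents_const.
Qed.

(** A bound rho^-n on the next derivative makes this one Lipschitz with that constant, so a distance
    of rho^(m+n) keeps the values within rho^m. *)
Lemma limit_partial_net j x xe L : gitv a b x -> represents xe x ->
  vrepresents (fun e => partials (nseq j 0) (fe e) (const_mx (xe e))) L ->
  limit_partial ab_line (nseq j 0) (on_gline f) (const_mx x) L.
Proof.
move=> xab xex feL r r0.
have [ae [be [aea beb xeab]]] := gitv_between xab xex.
have abe : \forall e \near 0^'+, ae e <= be e.
  by near=> e; have /andP[ax xb] := xeab e; exact: le_trans xb.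
have cd := gsf_net_is_derive fef (@subset_refl _ _) aea beb abe.
have [n cm] := gsf_net_moderate fef (@subset_refl _ _) aea beb abe j.+1.
have [m hm] := @coord_gvnorm_lt _ _ k _ r0.
pose P := (m + n)%N.
have rP := gaugeX_represents (rho := rho) P.
exists (gclass (fun e => rho e ^+ P)); first exact: gaugeX_gt0.
move=> y M yint yx fM.
have yab : gitv a b (y 0 0) by exact: (sharp_interior_subset yint).
have yE : y = const_mx (y 0 0) by apply/rowP => l; rewrite mxE ord1.
(* The endpoints are already adapted to [xe]; clamping [ye] places both points in [ae, be], where
   the derivatives are controlled. *)
have [ye yey yeab] := gitv_clamp aea beb abe yab.
rewrite yE in fM yx.
have feM := net_partial_unique yab yey fM.
have {}yx := gvnorm_lt_coord yx rP
  (vrepresents_sub (vrepresents_const yey) (vrepresents_const xex)).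
apply: (hm m _ _ (leqnn m) (vrepresents_sub feM feL)).
near=> e.
have /andP[e0 e1] : 0 < rho e < 1 by near: e; exact: gauge_small.
have yxe : forall i : 'I_1, `|(const_mx (ye e) - const_mx (xe e) : 'rV_1) 0 i| <= rho e ^+ P.
  by near: e.
have {}yxe := yxe 0; rewrite !mxE in yxe.
have cde : forall t, ae e <= t <= be e ->
  forall j i, is_derive t 1 (fun t : R => partials (nseq j 0) (fe e) (const_mx t) 0 i)
    (partials (nseq j.+1 0) (fe e) (const_mx t) 0 i) by near: e.
have cme : forall i t, ae e <= t <= be e ->
    `|partials (nseq j.+1 0) (fe e) (const_mx t) 0 i| * rho e ^+ n <= 1 by near: e.
have abee : ae e <= be e by near: e.
move=> i; rewrite !mxE.
have [z [zab _] ->] := MVT_between (fun t tab => cde t tab j i) (xeab e) (yeab e abee).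
rewrite normrM; apply: (le_trans (ler_wpM2l (normr_ge0 _) yxe)).
rewrite /P [(m + n)%N]addnC exprD mulrA ler_piMl ?exprn_ge0 ?(ltW e0)//.
exact: cme.
Unshelve. all: by end_near. Qed.

(** The limit condition speaks of interior points and would be vacuous if none were near [x].
    [sharp_interior_dense] gives one within both radii; the derivative there is close to [L] and to
    [L0]. *)
Lemma limit_partial_unique j x xe L : gitv a b x -> represents xe x ->
  limit_partial ab_line (nseq j 0) (on_gline f) (const_mx x) L ->
  vrepresents (fun e => partials (nseq j 0) (fe e) (const_mx (xe e))) L.
Proof.
move=> xab xex fL; have [L0 [feL0 _]] := gsf_net_partial j xab xex.
have fL0 := limit_partial_net xab xex feL0.
suff -> : L = L0 by [].
apply/rowP => i.
apply: (represents_close (grepr_represents (L 0 i)) (grepr_represents (L0 0 i))) => n.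
have rn := gaugeX_represents (rho := rho) n.+1.
have [q1 q10 h1] := fL _ (gaugeX_gt0 n.+1).
have [q2 q20 h2] := fL0 _ (gaugeX_gt0 n.+1).
have [m1 hm1] := @coord_gvnorm_lt _ _ 1 _ q10.
have [m2 hm2] := @coord_gvnorm_lt _ _ 1 _ q20.
have [ae [be [aea beb xeab]]] := gitv_between xab xex.
have [y [ye [yey yint yab _ yx]]] :=
  sharp_interior_dense ab (maxn m1 m2) xab aea beb xex (fun e _ => xeab e).
have [M [_ fM]] := gsf_net_partial j yab yey.
have yxr := vrepresents_sub (vrepresents_const yey) (vrepresents_const xex).
have yx' : \forall e \near 0^'+, forall i : 'I_1,
    `|(const_mx (ye e) - const_mx (xe e) : 'rV_1) 0 i| <= rho e ^+ maxn m1 m2.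
  by apply: filterS yx => e h l; rewrite !mxE.
have ML := h1 _ _ yint (hm1 _ _ _ (leq_maxl _ _) yxr yx') fM.
have ML0 := h2 _ _ yint (hm2 _ _ _ (leq_maxr _ _) yxr yx') fM.
have rv (V : 'rV[Rt]_k) : vrepresents (fun e => \row_l grepr (V 0 l) e) V.
  apply/vrepresentsP => l; under eq_fun do rewrite mxE; exact: grepr_represents.
have {}ML := gvnorm_lt_coord ML rn (vrepresents_sub (rv M) (rv L)).
have {}ML0 := gvnorm_lt_coord ML0 rn (vrepresents_sub (rv M) (rv L0)).
near=> e.
have /andP[e0 e1] : 0 < rho e < 4^-1.
  by near: e; apply: gauge_small; rewrite invr_gt0.
have : forall l, `|(\row_l grepr (M 0 l) e - \row_l grepr (L 0 l) e) 0 l| <= rho e ^+ n.+1.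
  by near: e.
have : forall l, `|(\row_l grepr (M 0 l) e - \row_l grepr (L0 0 l) e) 0 l| <= rho e ^+ n.+1.
  by near: e.
move=> /(_ i) + /(_ i); rewrite !mxE.
have : rho e ^+ n.+1 <= 4^-1 * rho e ^+ n by rewrite exprn_quarter ?e0 ?(ltW e1).
have : 0 < rho e ^+ n by rewrite exprn_gt0.
move: (grepr (M 0 i) e) (grepr (L 0 i) e) (grepr (L0 0 i) e) (rho e ^+ n) (rho e ^+ n.+1).
move=> x1 x2 x3 x4 x5 ? ?; rewrite !ler_norml => /andP[? ?] /andP[? ?].
by apply/andP; split; lra.
Unshelve. all: by end_near. Qed.

(** The case distinction in [gpartial] disappears on [a, b]: both kinds of value are the class of
    the derivative net. *)
Lemma gderiv_represents j x xe : gitv a b x -> represents xe x ->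
  vrepresents (fun e => partials (nseq j 0) (fe e) (const_mx (xe e)))
    (gderiv (gitv a b) j f x).
Proof.
move=> xab xex; have [L [feL fL]] := gsf_net_partial j xab xex.
rewrite /gderiv /gpartial.
case: xgetP => [L' -> [[_ fL']|[_ fL']]|none].
- exact: net_partial_unique fL'.
- exact: limit_partial_unique fL'.
(* A value exists in either case, so the default of [xget] is excluded. *)
- exfalso; have [xi|xni] := pselect (sharp_interior ab_line (const_mx x)).
    by apply: (none L); left.
  by apply: (none L); right; split=> //; exact: limit_partial_net feL.
Qed.

End DerivativeOfGsf.

(** The rules for [partials] hold on an open domain, so differentiability has to pass between
    functions that agree only near the point. *)
Lemma near_eq_differentiable (R : realFieldType) (V W : normedModType R) (f g : V -> W) (x : V) :
  (\forall y \near x, f y = g y) -> differentiable f x -> differentiable g x.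
Proof.
move=> fg df; have fgx := nbhs_singleton fg.
have [dfc dfx] := (diff_locallyP x f).1 df.
have dgx : g \o shift x = cst (g x) + 'd f x +o_ 0 id.
  apply/eqaddoP => eps eps0.
  have /eqaddoP/(_ eps eps0) := dfx; apply: filter_app.
  have /= : \forall h \near 0, f (h + x) = g (h + x).
    by move: fg; rewrite (near_shift 0) subr0.
  by apply: filterS => h fgh; rewrite !fctE /= fgh fgx.
apply/diff_locallyP; rewrite (diff_unique dfc dgx); split=> //.
Qed.

(** * Sums and multiples of generalized smooth functions *)

Section SmoothOn.
Context {R : realType} (n k : nat).
Implicit Types (D : set 'rV[R]_n) (f g : 'rV[R]_n -> 'rV[R]_k).

(** The equality is carried on all of [D] because differentiating it once more requires it in a
    neighbourhood. *)
Lemma partialsD D f g s x : open D -> smooth_on D f -> smooth_on D g -> D x ->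
  partials s (fun y => f y + g y) x = partials s f x + partials s g x.
Proof.
move=> Do fD gD; elim: s x => [//|i s IH] x Dx /=.
have near_eq : \forall y \near x, partials s (fun y => f y + g y) y =
    (partials s f + partials s g) y.
  by near=> y; apply: IH; near: y; exact: open_nbhs_nbhs.
rewrite (near_eq_derive _ near_eq) deriveD//; apply: diff_derivable; [exact: fD|exact: gD].
Unshelve. all: by end_near. Qed.

Lemma partialsZ D f c s x : open D -> smooth_on D f -> D x ->
  partials s (fun y => c *: f y) x = c *: partials s f x.
Proof.
move=> Do fD; elim: s x => [//|i s IH] x Dx /=.
have near_eq : \forall y \near x, partials s (fun y => c *: f y) y =
    (c \*: partials s f) y.
  by near=> y; apply: IH; near: y; exact: open_nbhs_nbhs.
rewrite (near_eq_derive _ near_eq) deriveZ//; apply: diff_derivable; exact: fD.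
Unshelve. all: by end_near. Qed.

Lemma smooth_onD D f g : open D -> smooth_on D f -> smooth_on D g ->
  smooth_on D (fun y => f y + g y).
Proof.
move=> Do fD gD s x Dx.
apply: (@near_eq_differentiable _ _ _ (partials s f + partials s g)).
  near=> y; apply/esym/(partialsD s Do fD gD); near: y; exact: open_nbhs_nbhs.
by apply: differentiableD; [exact: fD|exact: gD].
Unshelve. all: by end_near. Qed.

Lemma smooth_onZ D f c : open D -> smooth_on D f -> smooth_on D (fun y => c *: f y).
Proof.
move=> Do fD s x Dx.
apply: (@near_eq_differentiable _ _ _ (c *: partials s f)).
  near=> y; apply/esym/(partialsZ c s Do fD); near: y; exact: open_nbhs_nbhs.
by apply: differentiableZ; exact: fD.
Unshelve. all: by end_near. Qed.

Lemma smooth_onS D D' f : D' `<=` D -> smooth_on D f -> smooth_on D' f.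
Proof. by move=> DD' fD s x /DD'; exact: fD. Qed.

End SmoothOn.

Section GsfAlgebra.
Context {R : realType} {rho : asymptotic_gauge R}.
Local Notation Rt := (gnum rho).
Variables (n k : nat) (X : set 'rV[Rt]_n).
Implicit Types f g : 'rV[Rt]_n -> 'rV[Rt]_k.

Lemma gsf_netS Om fe X' f : X' `<=` X -> gsf_net Om fe X f -> gsf_net Om fe X' f.
Proof.
move=> X'X [sm inOm fv fm]; split=> //.
- by move=> x /X'X/inOm.
- by move=> xe x /X'X; exact: fv.
- by move=> s xe x /X'X; exact: fm.
Qed.

Lemma gsf_netD Om fe f Om' ge g : gsf_net Om fe X f -> gsf_net Om' ge X g ->
  gsf_net (fun e => Om e `&` Om' e) (fun e x => fe e x + ge e x) X
    (fun x => f x + g x).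
Proof.
move=> [sm inOm fv fm] [sm' inOm' gv gm].
have sm2 e : I0 e -> [/\ open (Om e `&` Om' e), smooth_on (Om e `&` Om' e) (fe e)
    & smooth_on (Om e `&` Om' e) (ge e)].
  move=> Ie; have [Do s1] := sm _ Ie; have [Do2 s2] := sm' _ Ie; split; first exact: openI.
    by apply: smooth_onS s1 => ? [].
  by apply: smooth_onS s2 => ? [].
split.
- by move=> e /sm2[Do s1 s2]; split=> //; exact: smooth_onD.
- move=> x xX xe xex; have h1 := inOm _ xX _ xex; have h2 := inOm' _ xX _ xex.
  by apply: filterS2 h1 h2.
- by move=> xe x xX xex; apply: vrepresents_add; [exact: fv|exact: gv].
- move=> s xe x xX xex; have h1 := inOm _ xX _ xex; have h2 := inOm' _ xX _ xex.
  apply: (@vnet_moderate_near _ _ _ (fun e => partials s (fe e) (xe e) + partials s (ge e) (xe e))).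
    near=> e; have /sm2[Do s1 s2] : I0 e by near: e; exact: near_I0.
    rewrite (partialsD s Do s1 s2)//; split; near: e; [exact: h1|exact: h2].
  (* Moderateness of the sum is read off from the sum of the two classes. *)
  have [] : vrepresents (fun e => partials s (fe e) (xe e) + partials s (ge e) (xe e))
    (gvec (rho := rho) (fun e => partials s (fe e) (xe e)) +
     gvec (fun e => partials s (ge e) (xe e))).
    by apply: vrepresents_add; split=> //; [exact: fm xX xex|exact: gm xX xex].
  by [].
Unshelve. all: by end_near. Qed.

Lemma gsf_netZ Om fe f c C : represents c C -> gsf_net Om fe X f ->
  gsf_net Om (fun e x => c e *: fe e x) X (fun x => C *: f x).
Proof.
move=> cC [sm inOm fv fm]; split=> //.
- by move=> e /sm[Do s1]; split=> //; exact: smooth_onZ.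
- by move=> xe x xX xex; apply: vrepresents_scale => //; exact: fv.
- move=> s xe x xX xex; have h1 := inOm _ xX _ xex.
  apply: (@vnet_moderate_near _ _ _ (fun e => c e *: partials s (fe e) (xe e))).
    near=> e; have /sm[Do s1] : I0 e by near: e; exact: near_I0.
    by rewrite (partialsZ (c e) s Do s1)//; near: e; exact: h1.
  have [] : vrepresents (fun e => c e *: partials s (fe e) (xe e))
    (C *: gvec (rho := rho) (fun e => partials s (fe e) (xe e))).
    by apply: vrepresents_scale => //; split=> //; exact: fm xX xex.
  by [].
Unshelve. all: by end_near. Qed.

End GsfAlgebra.

(** * The norms of small variations *)

Section Extrema.
Context {R : realType} {rho : asymptotic_gauge R}.
Local Notation Rt := (gnum rho).
Variables (a b : Rt) (d : nat) (f : Rt -> 'rV[Rt]_d).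
Hypothesis ab : a <~ b.
Hypothesis f_gsf : gsf1 (gitv a b) f.

Let ae := grepr a.
Let be := grepr b.
Let aea : represents ae a := grepr_represents a.
Let beb : represents be b := grepr_represents b.

Let abe : \forall e \near 0^'+, ae e <= be e.
Proof. exact: glt_near_le ab. Qed.

(** The maximizers of the derivative net form a generalized point, and every other point has a
    clamped representative to compare with it. *)
Lemma gderiv_max j i : exists M, gitv a b M /\
  forall t, gitv a b t -> gderiv (gitv a b) j f t 0 i <=~ gderiv (gitv a b) j f M 0 i.
Proof.
have [Om [fe fef]] := f_gsf.
have cd := gsf_net_is_derive fef (@subset_refl _ _) aea beb abe.
have [|te teP] := @near_EVT_max _ _ _
    (fun e t => partials (nseq j 0) (fe e) (const_mx t) 0 i) abe.
  by apply: filterS cd => e h t tab; exact: is_derive_continuous (h t tab j i).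
have tab : \forall e \near 0^'+, ae e <= te e <= be e by apply: filterS teP => e [].
have [teM Mab] := gitv_represents aea beb tab.
exists (gclass te); split=> // t t_ab.
have [se set seab] := gitv_clamp aea beb abe t_ab.
have /vrepresentsP/(_ i) Mr := gderiv_represents ab fef j Mab teM.
have /vrepresentsP/(_ i) tr := gderiv_represents ab fef j t_ab set.
apply: (gle_near tr Mr); near=> e.
have [_ +] : ae e <= te e <= be e /\ forall t, ae e <= t <= be e ->
  partials (nseq j 0) (fe e) (const_mx t) 0 i <=
  partials (nseq j 0) (fe e) (const_mx (te e)) 0 i by near: e.
by apply; apply: seab; near: e.
Unshelve. all: by end_near. Qed.

Lemma gderivZ c C j t : represents c C -> gitv a b t ->
  gderiv (gitv a b) j (fun t => C *: f t) t = C *: gderiv (gitv a b) j f t.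
Proof.
move=> cC tab; have [Om [fe fef]] := f_gsf; have te := grepr_represents t.
have cfef : gsf_net Om (fun e x => c e *: fe e x) (gline (gitv a b))
    (on_gline (fun t => C *: f t)) by exact: gsf_netZ.
have [sm inOm _ _] := fef.
have tX : gline (gitv a b) (const_mx t) by rewrite /gline /= mxE.
have tOm := inOm _ tX _ (vrepresents_const te).
have /vrepresentsP h1 := gderiv_represents ab cfef j tab te.
have /vrepresentsP h2 := vrepresents_scale cC (gderiv_represents ab fef j tab te).
apply/rowP => i; apply: represents_inj (h2 i); apply: represents_near (h1 i).
near=> e; have [Do smD] : open (Om e) /\ smooth_on (Om e) (fe e).
  by apply: sm; near: e; exact: near_I0.
by rewrite (partialsZ (c e) _ Do smD)//; near: e.
Unshelve. all: by end_near. Qed.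

End Extrema.

Section LocalMinimizers.
Context {R : realType} {rho : asymptotic_gauge R}.
Local Notation Rt := (gnum rho).
Variables (a b : Rt) (d : nat).
Hypothesis ab : a <~ b.

Lemma gsf1Z c C (f : Rt -> 'rV[Rt]_d) X : represents c C -> gsf1 X f ->
  gsf1 X (fun t => C *: f t).
Proof.
by move=> cC [Om [fe fef]]; exists Om, (fun e x => c e *: fe e x); exact: gsf_netZ.
Qed.

Lemma gderivZ_coord (f : Rt -> 'rV[Rt]_d) c C j t i : gsf1 (gitv a b) f ->
  represents c C -> gitv a b t ->
  gderiv (gitv a b) j (fun t => C *: f t) t 0 i = C * gderiv (gitv a b) j f t 0 i.
Proof.
move=> f_gsf cC tab.
exact: etrans (congr1 (fun V : 'rV_d => V 0 i) (gderivZ ab f_gsf j cC tab)) (scale_coord _ _ _).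
Qed.

Lemma gderiv_min (f : Rt -> 'rV[Rt]_d) j i : gsf1 (gitv a b) f ->
  exists M, gitv a b M /\
  forall t, gitv a b t -> gderiv (gitv a b) j f M 0 i <=~ gderiv (gitv a b) j f t 0 i.
Proof.
move=> f_gsf; have m1 := represents_opp (represents1 (rho := rho)).
have [M [Mab Mmax]] := gderiv_max ab (gsf1Z m1 f_gsf) j i.
have E s (sab : gitv a b s) := etrans (gderivZ_coord j i f_gsf m1 sab) (mulN1r _).
exists M; split=> [|t tab]; first exact: Mab.
exact: gle_opp (E t tab) (E M Mab) (Mmax t tab).
Qed.

(** The derivatives up to order [m] share a moderate bound rho^-nn, and each is multiplied by s
    rho^N; a large [N] outweighs both this bound and the size of [r]. *)
Lemma Cnorm_small (f : Rt -> 'rV[Rt]_d) m r : gsf1 (gitv a b) f -> 0 <~ r ->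
  exists N0, forall N s, (N0 <= N)%N -> `|s| = 1 ->
  Cnorm a b m (fun t => gclass (fun e => s * rho e ^+ N) *: f t) <~ r.
Proof.
move=> f_gsf r0; have [Om [fe fef]] := f_gsf.
have aea := grepr_represents a; have beb := grepr_represents b.
have rr := grepr_represents r.
have [q rq] := (gltP represents0 rr).1 r0.
have abe := glt_near_le aea beb ab.
have /choice[n hn] := gsf_net_moderate fef (@subset_refl _ _) aea beb abe.
pose nn := \max_(k < m.+1) n k.
(* [nn] compensates the derivatives, [q] reaches below [r], and the last power makes the inequality
   strict. *)
exists (nn + q.+1)%N => N s N0N s1.
have sN : net_moderate rho (fun e => s * rho e ^+ N).
  exact: moderateM (moderate_cst rho s) (moderate_gaugeX rho N).
have rs := represents_gclass sN.
have rB := gaugeX_represents (rho := rho) q.+1.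
apply: (@gle_lt_trans _ _ _ (gclass (fun e => rho e ^+ q.+1))); last first.
  apply/(gltP rB rr); exists q.+1; near=> e.
  have /andP[e0 e1] : 0 < rho e < 4^-1.
    by near: e; apply: gauge_small; rewrite invr_gt0.
  have : 0 + rho e ^+ q <= grepr r e by near: e.
  have : rho e ^+ q.+1 <= 4^-1 * rho e ^+ q by rewrite exprn_quarter ?e0 ?(ltW e1).
  have : 0 < rho e ^+ q by rewrite exprn_gt0.
  by move: (rho e ^+ q) (rho e ^+ q.+1) (grepr r e) => x y z; lra.
have B0 : 0 <=~ (gclass (fun e => rho e ^+ q.+1) : Rt).
  apply: (gle_near represents0 rB); near=> e.
  have /andP[e0 _] : 0 < rho e < 1 by near: e; exact: gauge_small.
  by rewrite exprn_ge0 ?ltW.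
apply: (big_ind (fun Z => Z <=~ gclass (fun e => rho e ^+ q.+1))) => //.
  by move=> X Y; exact: gmax_le.
move=> k _.
apply: (big_ind (fun Z => Z <=~ gclass (fun e => rho e ^+ q.+1))) => //.
  by move=> X Y; exact: gmax_le.
move=> i _.
set vki := fun t : Rt => _.
have key t : gitv a b t -> gabs (vki t) <=~ gclass (fun e => rho e ^+ q.+1).
  move=> tab; rewrite /vki (gderivZ_coord k i f_gsf rs tab).
  have [te tte teab] := gitv_clamp aea beb abe tab.
  have /vrepresentsP/(_ i) tr := gderiv_represents ab fef k tab tte.
  apply: (gle_near (gabs_represents (represents_mul rs tr)) rB); near=> e.
  have /andP[e0 e1] : 0 < rho e < 1 by near: e; exact: gauge_small.
  have he : forall i t, grepr a e <= t <= grepr b e ->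
    `|partials (nseq k 0) (fe e) (const_mx t) 0 i| * rho e ^+ n k <= 1.
    by near: e; exact: hn.
  rewrite !normrM s1 mul1r normrX gtr0_norm//.
  have nk : (n k <= nn)%N by exact: (leq_bigmax k).
  have rN : rho e ^+ N <= rho e ^+ (q.+1 + n k).
    by rewrite ler_wiXn2l ?(ltW e0) ?(ltW e1)//; lia.
  have hk := he i _ (teab e _); apply: (le_trans (ler_wpM2r (normr_ge0 _) rN)).
  rewrite exprD -mulrA ler_piMr ?exprn_ge0 ?(ltW e0)//.
  by rewrite mulrC; apply: hk; near: e.
(* [gargmax] and [gargmin] are known to lie in [a, b] because extrema exist; the default 0 might lie
   outside, where [key] says nothing. *)
have [M Mmax] := gderiv_max ab (gsf1Z rs f_gsf) k i.
have [M' Mmin] := gderiv_min k i (gsf1Z rs f_gsf).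
apply: gmax_le; apply: key.
  by have [] := xgetPex 0 (ex_intro [set M | gitv a b M /\
    forall t, gitv a b t -> vki t <=~ vki M] M Mmax).
by have [] := xgetPex 0 (ex_intro [set M | gitv a b M /\
    forall t, gitv a b t -> vki M <=~ vki t] M' Mmin).
Unshelve. all: by end_near. Qed.

(** As [eta] vanishes at both ends, the varied curve keeps the boundary values; its difference from
    [u] is the multiple estimated by [Cnorm_small]. *)
Lemma local_minimizer_variation (I : (Rt -> 'rV[Rt]_d) -> Rt) p q u eta :
  local_minimizer a b I p q u -> gsf0 a b eta ->
  exists N0, forall N s, (N0 <= N)%N -> `|s| = 1 ->
  I u <=~ I (fun t => u t + gclass (fun e => s * rho e ^+ N) *: eta t).
Proof.
move=> [[u_gsf ua ub] [r [m [r0 umin]]]] [eta_gsf etaa etab].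
have {}eta_gsf : gsf1 (gitv a b) eta.
  by have [Om [fe fef]] := eta_gsf; exists Om, fe; exact: gsf_netS fef.
have [N0 hN] := Cnorm_small m eta_gsf r0.
exists N0 => N s N0N s1; pose S : Rt := gclass (fun e => s * rho e ^+ N).
have rS : represents (fun e => s * rho e ^+ N) S.
  exact/represents_gclass/(moderateM (moderate_cst rho s) (moderate_gaugeX rho N)).
have v_gsf : gsf1 (gitv a b) (fun t => u t + S *: eta t).
  have [Om [fe fef]] := u_gsf; have [Om' [ge gef]] := gsf1Z rS eta_gsf.
  by eexists; eexists; exact: gsf_netD fef gef.
apply: umin; last by split=> //; rewrite ?etaa ?etab scaler0 addr0.
split=> //; rewrite (_ : (fun t => _) = (fun t => S *: eta t)); first exact: hN.
by apply/funext => t; rewrite addrAC subrr add0r.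
Qed.

End LocalMinimizers.

(** * Fermat's principle *)

Section FermatPrinciple.
Context {R : realType} {rho : asymptotic_gauge R}.
Local Notation Rt := (gnum rho).
Variables (phi : Rt -> Rt) (N0 : nat).
Hypothesis phi_min : forall N (s : R), (N0 <= N)%N -> `|s| = 1 ->
  phi 0 <=~ phi (gclass (fun e => s * rho e ^+ N)).

(* If phi is not a generalized smooth function, gderiv has the default value 0 of
   xget: smoothness of s |-> I(u + s eta) is therefore never required. *)
Lemma gderiv_line_spec m :
  gderiv setT m (scalar_fun phi) 0 0 0 = 0 \/
  exists Om fe xe, [/\ gsf_net Om fe (gline setT) (on_gline (scalar_fun phi)),
    represents xe (0 : Rt)
    & represents (fun e => partials (nseq m 0) (fe e) (const_mx (xe e)) 0 0)
        (gderiv setT m (scalar_fun phi) 0 0 0)].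
Proof.
rewrite /gderiv /gpartial; case: xgetP => [L -> [[_ fL]|[nint _]]|_].
- right; have [Om [fe [xe [fef /vrepresentsP xe0 /vrepresentsP feL]]]] := fL.
  exists Om, fe, (fun e => xe e 0 0); split=> //.
    by have := xe0 0; rewrite mxE.
  have -> : (fun e => partials (nseq m 0) (fe e) (const_mx (xe e 0 0)) 0 0) =
      (fun e => partials (nseq m 0) (fe e) (xe e) 0 0).
    apply/funext => e; rewrite (_ : const_mx (xe e 0 0) = xe e)//.
    by apply/rowP => l; rewrite mxE ord1.
  exact: feL.
(* Every point of the whole line is sharply interior, with radius 1 for instance, so the limit
   branch cannot occur. *)
- exfalso; apply: nint; exists 1 => //.
  by apply/(gltP represents0 represents1); exists 0; near=> e; rewrite add0r expr0.
- by left; rewrite mxE.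
Unshelve. all: by end_near. Qed.

Section Net.
Variables (Om : R -> set 'rV[R]_1) (fe : R -> 'rV[R]_1 -> 'rV[R]_1) (xe : R -> R).
Hypothesis fef : gsf_net Om fe (gline setT) (on_gline (scalar_fun phi)).
Hypothesis xe0 : represents xe (0 : Rt).

Let h j e t := partials (nseq j 0) (fe e) (const_mx t) 0 0.
Let m1 := represents_opp (represents1 (rho := rho)).
Let p1 := represents1 (rho := rho).
Let mp : \forall e \near (0 : R)^'+, (-1 : R) <= 1.
Proof. by near=> e; lra. Unshelve. all: by end_near. Qed.
Let sub1 : gline (gitv (-1 : Rt) 1) `<=` gline setT.
Proof. by []. Qed.

(** The window [-1, 1] takes the place of [ae, be]: for small [e] it contains the representative of
    0 and the test points around it. *)
Lemma line_is_derive j : \forall e \near 0^'+, forall t : R, -1 <= t <= 1 ->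
  is_derive t 1 (h j e) (h j.+1 e t).
Proof.
apply: filterS (gsf_net_is_derive fef sub1 m1 p1 mp) => e H t tI; exact: H.
Qed.

Lemma line_moderate j : exists n, \forall e \near 0^'+, forall t : R, -1 <= t <= 1 ->
  `|h j e t| * rho e ^+ n <= 1.
Proof.
have [n hn] := gsf_net_moderate fef sub1 m1 p1 mp j; exists n.
by apply: filterS hn => e H t tI; exact: H.
Qed.

(** The bound 1/2 leaves room in [-1, 1] for a step in both directions. *)
Lemma line_small : \forall e \near 0^'+, `|xe e| <= 2^-1.
Proof.
have /negligible_natP/(_ 1) := represents_eq xe0 represents0; apply: filter_app.
near=> e; rewrite !fctE subr0 expr1 => /le_trans; apply; rewrite ltW//; near: e.
by apply: gauge_lt; rewrite invr_gt0.
Unshelve. all: by end_near. Qed.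

(** Since [xe] represents 0, the net xe + s rho^N represents the same class as s rho^N; the test
    points are thus centred at [xe]. *)
Lemma line_min (s : R) N : (s = 1 \/ s = -1) -> (N0 <= N)%N ->
  forall n, \forall e \near 0^'+,
    h 0 e (xe e) <= h 0 e (xe e + s * rho e ^+ N) + rho e ^+ n.
Proof.
move=> s1 N0N; have [_ _ fv _] := fef.
have {}s1 : `|s| = 1 by case: s1 => ->; rewrite ?normrN1 ?normr1.
have rS := represents_gclass (moderateM (moderate_cst rho s) (moderate_gaugeX rho N)).
have xS := represents_add xe0 rS; rewrite add0r in xS.
have /vrepresentsP/(_ 0) v0 := fv _ _ (I : gline setT _) (vrepresents_const xe0).
have /vrepresentsP/(_ 0) v1 := fv _ _ (I : gline setT _) (vrepresents_const xS).
rewrite /on_gline /scalar_fun !mxE in v0 v1.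
exact: (gleP v0 v1).1 (phi_min N0N s1).
Qed.

End Net.

Lemma gderiv_fermat : gderiv setT 1 (scalar_fun phi) 0 0 0 = 0.
Proof.
have [//|[Om [fe [xe [fef xe0 hL]]]]] := gderiv_line_spec 1.
apply: (represents_close hL represents0).
have /negligible_natP := fermat_net (line_small xe0) (line_min fef xe0)
  (line_is_derive fef 0) (line_is_derive fef 1) (line_moderate fef 2).
by move=> h n; apply: filterS (h n) => e; rewrite subr0.
Qed.

Lemma gderiv_fermat2 : 0 <=~ gderiv setT 2 (scalar_fun phi) 0 0 0.
Proof.
have [->|[Om [fe [xe [fef xe0 hL]]]]] := gderiv_line_spec 2.
  by apply: (gle_near represents0 represents0); near=> e.
apply/(gleP represents0 hL) => n.
have := fermat_net2 (line_small xe0) (line_min fef xe0)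
  (line_is_derive fef 0) (line_is_derive fef 1) (line_is_derive fef 2) (line_moderate fef 3) n.
by apply: filterS => e; lra.
Unshelve. all: by end_near. Qed.

End FermatPrinciple.

Theorem theorem43 (R : realType) (rho : asymptotic_gauge R) (d : nat) (a b : gnum rho)
    (F : gnum rho -> 'rV[gnum rho]_d -> 'rV[gnum rho]_d -> gnum rho)
    (p q : 'rV[gnum rho]_d) (u : gnum rho -> 'rV[gnum rho]_d)
    (hab : a <~ b) (hF : lagrangian a b F)
    (hu : local_minimizer a b (gaction a b F) p q u) :
  (forall eta : gnum rho -> 'rV[gnum rho]_d, gsf0 a b eta ->
     gvariation 1 (gaction a b F) u eta = 0) /\
  (forall eta : gnum rho -> 'rV[gnum rho]_d, gsf0 a b eta ->
     0 <=~ gvariation 2 (gaction a b F) u eta).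
Proof.
(* The base point is written with 0 *: eta so that it is literally the value at 0 of s |-> I(u + s
   eta). *)
have key eta : gsf0 a b eta -> exists N0, forall N (s : R), (N0 <= N)%N -> `|s| = 1 ->
    gaction a b F (fun t => u t + 0 *: eta t) <=~
    gaction a b F (fun t => u t + gclass (fun e => s * rho e ^+ N) *: eta t).
  move=> /(local_minimizer_variation hab hu).
  suff -> : (fun t => u t + 0 *: eta t) = u by [].
  by apply/funext => t; rewrite scale0r addr0.
split=> eta /key[N0 hN].
  exact: (gderiv_fermat (phi := fun s => gaction a b F (fun t => u t + s *: eta t)) hN).
exact: (gderiv_fermat2 (phi := fun s => gaction a b F (fun t => u t + s *: eta t)) hN).
Qed.
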